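(* Let $L$ be a separable complex Hilbert space with a conjugation, and let $\mathcal F$ be the fermionic Fock space over $L$ with number operator $N$. Let $1\le r\le 2$, let $A\in B_r^-(L)$, and put $s:=\frac{2(r-1)}{r}$. Then, on the finite-particle subspace $\mathcal F_0$, $$ \Delta(A)^*\Delta(A)\le \begin{cases} \|A\|_1^2\,\mathbb 1, & r=1,\\ \|A\|_r^2\,N^s+\|A\|_2^2\,\mathbb 1, & 1<r\le 2. \end{cases} $$
   Context: Inner products are antilinear in the first and linear in the second argument. $L$ is a separable complex Hilbert space with a conjugation $f\mapsto\bar f$ (antilinear isometric involution). Fock representation of the CAR over $L$: $\mathcal F$ is a complex Hilbert space and $f\mapsto a(f)$, $f\mapsto a^\dagger(f)$ are linear maps from $L$ into the bounded operators on $\mathcal F$ with $\{a(f),a(g)\}=0=\{a^\dagger(f),a^\dagger(g)\}$, $\{a(f),a^\dagger(g)\}=(\bar f,g)\mathbb 1$ (anticommutators), $a(f)^*=a^\dagger(\bar f)$, together with a unit vector $\Omega\in\mathcal F$ (vacuum) such that $a(f)\Omega=0$ for all $f\in L$ and the vectors $a^\dagger(f_n)\cdots a^\dagger(f_1)\Omega$ ($n\ge 0$, $f_i\in L$) span a dense subspace of $\mathcal F$. The $n$-particle space $\mathcal F^{(n)}$ is the closed span of the vectors $a^\dagger(f_n)\cdots a^\dagger(f_1)\Omega$; $\mathcal F$ is the orthogonal sum of the $\mathcal F^{(n)}$, $n\ge0$. $\mathcal F_0$ is the linear span of $\bigcup_n\mathcal F^{(n)}$. The transpose of a bounded operator $A$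 on $L$ is $A^T:=\bar A^*$, where $\bar A f:=\overline{A\bar f}$. $B_r(L)$, $1\le r<\infty$, is the $r$-th von Neumann-Schatten class on $L$ with norm $\|A\|_r=(\sum_j\mu_j^r)^{1/r}$, $\mu_j$ the singular values of $A$, and $B_r^-(L)$ is the set of $A\in B_r(L)$ with $A^T=-A$. For $A\in B_2^-(L)$, $\Delta(A):=\sum_j a(Ae_j)a(\bar e_j)$ on $\mathcal F_0$, where $\{e_j\}$ is a complete orthonormal system in $L$ (well-defined on $\mathcal F_0$; maps $\mathcal F^{(n)}$ into $\mathcal F^{(n-2)}$). The number operator is $N:=\sum_j a^\dagger(e_j)a(\bar e_j)$; $N\Phi=n\Phi$ and $N^s\Phi=n^s\Phi$ for $\Phi\in\mathcal F^{(n)}$. Operator inequalities $X\le Y$ are meant as $(\Phi,X\Phi)\le(\Phi,Y\Phi)$ for all $\Phi\in\mathcal F_0$, with $(\Phi,T^*T\Phi)=\|T\Phi\|^2$. *)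

(* Defs.v *)
From HB Require Import structures.
From mathcomp Require Import all_boot all_order all_algebra.
From mathcomp Require Import complex.
From mathcomp Require Import all_classical all_reals all_analysis.
Set Implicit Arguments.
Unset Strict Implicit.
Unset Printing Implicit Defensive.
Import Order.TTheory GRing.Theory Num.Theory.
Import numFieldNormedType.Exports.
Local Open Scope classical_set_scope.
Local Open Scope ring_scope.
Local Open Scope complex_scope.

(* Complex Hilbert spaces. The inner product is antilinear in its first and
   linear in its second argument; the norm `|x| is R[i]-valued (a nonnegative
   real number seen as a complex one), as in any normedModType over R[i]. *)
HB.mixin Record isHilbert (R : realType) (V : Type)
    & CompleteNormedModule R[i] V := {
  inner : V -> V -> R[i] ;
  innerDr : forall x y z : V, inner x (y + z) = inner x y + inner x z ;
  innerZr : forall (c : R[i]) (x y : V), inner x (c *: y) = c * inner x y ;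
  inner_conj : forall x y : V, inner y x = (inner x y)^* ;
  inner_norm : forall x : V, inner x x = `|x| ^+ 2
}.

#[short(type="hilbertType")]
HB.structure Definition Hilbert (R : realType) :=
  {V of isHilbert R V & CompleteNormedModule R[i] V}.

Section linear_span.
Variables (K : numDomainType) (V : lmodType K).

Definition lspan (S : set V) : set V :=
  [set x | exists (n : nat) (c : 'I_n -> K) (v : 'I_n -> V),
    (forall i, S (v i)) /\ x = \sum_i c i *: v i].

Definition lin_indep (n : nat) (v : 'I_n -> V) : Prop :=
  forall c : 'I_n -> K, \sum_i c i *: v i = 0 -> forall i, c i = 0.

End linear_span.

(* The dimension of a linear subspace W, with value +oo if it is infinite. *)
Definition dimension (R : realType) (V : lmodType R[i]) (W : set V) : \bar R :=
  ereal_sup [set n%:R%:E | n in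
    [set n : nat | exists v : 'I_n -> V, (forall i, W (v i)) /\ lin_indep v]].

Section hilbert_space.
Variables (R : realType) (L : hilbertType R).

Definition separable : Prop := exists2 S : set L, countable S & dense S.

Definition conjugation (J : L -> L) : Prop :=
  [/\ forall f g, J (f + g) = J f + J g,
      forall (c : R[i]) f, J (c *: f) = c^* *: J f,
      forall f, `|J f| = `|f| &
      involutive J].

(* Complete orthonormal systems of a separable space are finite or countably
   infinite: they are indexed by a set D of natural numbers. *)
Definition complete_orthonormal (D : set nat) (e : nat -> L) : Prop :=
  (forall j k, D j -> D k -> inner (e j) (e k) = (j == k)%:R) /\
  dense (lspan (e @` D)).

(* B = A^*; for bounded A there is exactly one such B. *)
Definition is_adjoint (A B : L -> L) : Prop :=
  forall f g, inner (A f) g = inner f (B g).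

Definition conj_op (J A : L -> L) : L -> L := fun f => J (A (J f)).

(* B = A^T, the adjoint of conj_op J A. *)
Definition is_transpose (J A B : L -> L) : Prop := is_adjoint (conj_op J A) B.

Definition compact_operator (A : L -> L) : Prop :=
  precompact (A @` [set f | `|f| <= 1]).

(* The eigenspace of A^* A for the eigenvalue s^2; for s > 0 it is the
   eigenspace of |A| for the eigenvalue s. *)
Definition singular_space (A : L -> L) (s : R) : set L :=
  [set f | exists2 B, is_adjoint A B & B (A f) = (s ^+ 2)%:C *: f].

(* \sum_j mu_j^r over the nonzero singular values mu_j of A, each one repeated
   according to its multiplicity. *)
Definition schatten_sum (r : R) (A : L -> L) : \bar R :=
  \esum_(s in [set s : R | 0 < s])
    (dimension (singular_space A s) * (s `^ r)%:E)%E.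

Definition schatten_class (r : R) (A : L -> L) : Prop :=
  compact_operator A /\ (schatten_sum r A < +oo)%E.

Definition schatten_norm (r : R) (A : L -> L) : R :=
  fine (schatten_sum r A) `^ r^-1.

Definition skew_schatten_class (J : L -> L) (r : R) (A : L -> L) : Prop :=
  schatten_class r A /\ is_transpose J A (fun f => - A f).

End hilbert_space.

Section fock_space.
Variables (R : realType) (L F : hilbertType R) (J : L -> L).
Variables (a adag : L -> {linear F -> F}) (Omega : F).

(* particle_vector [:: f_n; ...; f_1] = adag f_n (... (adag f_1 Omega)). *)
Definition particle_vector (fs : seq L) : F :=
  foldr (fun f Phi => adag f Phi) Omega fs.

Record fock_representation : Prop := FockRepresentation {
  fock_a_linear : forall (c : R[i]) f g Phi,
    a (c *: f + g) Phi = c *: a f Phi + a g Phi ;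
  fock_adag_linear : forall (c : R[i]) f g Phi,
    adag (c *: f + g) Phi = c *: adag f Phi + adag g Phi ;
  fock_a_bounded : forall f, continuous (a f) ;
  fock_adag_bounded : forall f, continuous (adag f) ;
  fock_aa : forall f g Phi, a f (a g Phi) + a g (a f Phi) = 0 ;
  fock_adagadag : forall f g Phi,
    adag f (adag g Phi) + adag g (adag f Phi) = 0 ;
  fock_aadag : forall f g Phi,
    a f (adag g Phi) + adag g (a f Phi) = inner (J f) g *: Phi ;
  fock_adjoint : forall f, is_adjoint (a f) (adag (J f)) ;
  fock_vacuum_unit : `|Omega| = 1 ;
  fock_vacuum : forall f, a f Omega = 0 ;
  fock_cyclic : dense (lspan (range particle_vector))
}.

Definition particle_space (n : nat) : set F :=
  closure (lspan [set particle_vector fs | fs in [set fs | size fs = n]]).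

Definition finite_particle_space : set F :=
  lspan (\bigcup_n particle_space n).

(* N^s on the finite-particle space: multiplication by n^s on the n-particle
   space. The decomposition of Phi into n-particle vectors is unique, by
   orthogonality. *)
Definition number_pow (s : R) (Phi : F) : F :=
  get [set Psi | exists (m : nat) (phi : nat -> F),
    [/\ forall n, particle_space n (phi n),
        Phi = \sum_(n < m) phi n &
        Psi = \sum_(n < m) ((n%:R : R) `^ s)%:C *: phi n]].

(* \sum_j a(A e_j) a(J e_j) Phi, a norm limit of partial sums in F. *)
Definition Delta (A : L -> L) (D : set nat) (e : nat -> L) (Phi : F) : F :=
  limn (fun n : nat =>
    \sum_(j < n | (j : nat) \in D) a (A (e j)) (a (J (e j)) Phi)).

End fock_space.

(* Main.v *)
(* Write [mu_k] for the singular values of [A] and [f_k] for an orthonormal system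
   of eigenvectors of [A^* A], so that [Delta(A) = \sum_k a(A f_k) a(J f_k)] with
   [|A f_k| = mu_k]. Since [|a(g)| <= |g|], a [p]-particle vector [phi] satisfies
   [|Delta(A) phi| <= \sum_k mu_k x_k] with [x_k = |a(J f_k) phi|]. The CAR give
   [x_k <= |phi|], the number operator gives [\sum_k x_k^2 <= p |phi|^2], and
   Hölder's inequality yields [|Delta(A) phi| <= |A|_r p^(s/2) |phi|]. As [Delta(A)]
   maps different particle numbers to orthogonal spaces, the squares add up.

   Only finitely many eigenvectors are ever used: those outside of which [A] has
   norm at most [eps]. What they leave out of the basis expansion of [Delta(A)] is
   small because [\sum_j |A e_j|^2] and [\sum_j |a(J e_j) phi|^2] are finite. *)

Require Import Defs.
From HB Require Import structures.
From mathcomp Require Import all_boot all_order all_algebra.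
From mathcomp Require Import complex ring lra.
From mathcomp Require Import all_classical all_reals all_analysis.
Set Implicit Arguments.
Unset Strict Implicit.
Unset Printing Implicit Defensive.
Import Order.TTheory GRing.Theory Num.Theory.
Import numFieldNormedType.Exports.
Local Open Scope classical_set_scope.
Local Open Scope ring_scope.
Local Open Scope complex_scope.

(** * Real-valued norm and complex modulus *)

Section real_norm.
Variables (R : realType) (V : normedZmodType R[i]).
Implicit Types x y : V.

(** Two facts about [A] have to be earned. Its adjoint comes from the transpose condition, which
    yields [A^* = - J A J]. The eigenvectors of [A^* A] are found one at a time: on the orthogonal
    complement of those already found, the compact operator attains its norm, and does so at an
    eigenvector. The process stops because [n] orthonormal eigenvectors with [|A f| >= eps]
    contribute at least [n eps^r] to the finite Schatten sum. The main obstacle is that [Delta(A)]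
    is a limit of sums over a given basis [e], whereas Hölder's inequality needs sums over the
    eigenvectors. Let [P] project onto the chosen eigenvectors. A partial sum for [A P] can be
    rearranged exactly into a sum over eigenvectors. For [A (1 - P)] each of the first [M] terms is
    at most [eps |phi|], and the terms beyond [M] are controlled by a convergent majorant that
    depends neither on [P] nor on [eps]; hence [M] can be fixed before [eps]. *)

Definition nrm x : R := complex.Re `|x|.

(** The norm of a Hilbert space takes values in [R[i]]; this equation moves estimates into [R],
    where the order is total and real arithmetic applies. *)
Lemma nrmE x : `|x| = (nrm x)%:C.
Proof. by rewrite RRe_real // normr_real. Qed.

Lemma nrm_ge0 x : 0 <= nrm x.
Proof. by rewrite -ler0c -nrmE. Qed.

Lemma nrm0 : nrm 0 = 0.
Proof. by rewrite /nrm normr0. Qed.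

Lemma nrm_eq0 x : nrm x = 0 -> x = 0.
Proof. by move=> x0; apply/normr0_eq0; rewrite nrmE x0. Qed.

Lemma nrmN x : nrm (- x) = nrm x.
Proof. by rewrite /nrm normrN. Qed.

Lemma nrmB x y : nrm (x - y) = nrm (y - x).
Proof. by rewrite -nrmN opprB. Qed.

Lemma nrmD x y : nrm (x + y) <= nrm x + nrm y.
Proof. by rewrite -lecR rmorphD /= -!nrmE ler_normD. Qed.

Lemma nrm_triangle z x y : nrm (x - y) <= nrm (x - z) + nrm (z - y).
Proof. by rewrite -(subrKA z) nrmD. Qed.

Lemma nrm_leD x y : nrm x <= nrm y + nrm (x - y).
Proof. by rewrite -{1}(subrK y x) addrC nrmD. Qed.

Lemma nrm_sum I (s : seq I) (P : pred I) (f : I -> V) :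
  nrm (\sum_(i <- s | P i) f i) <= \sum_(i <- s | P i) nrm (f i).
Proof.
elim/big_rec2: _ => [|i y x _ xy]; first by rewrite nrm0.
by rewrite (le_trans (nrmD _ _)) // lerD2l.
Qed.

End real_norm.

Section complex_modulus.
Variable R : realType.
Implicit Types z w : R[i].

Lemma nrmM z w : nrm (z * w) = nrm z * nrm w.
Proof. by apply/complexI; rewrite rmorphM /= -!nrmE normrM. Qed.

Lemma nrmC (t : R) : nrm t%:C = `|t|.
Proof. by rewrite /nrm normc_def /= expr0n addr0 sqrtr_sqr. Qed.

Lemma conjcM z : conjc z * z = (nrm z ^+ 2)%:C.
Proof.
by rewrite rmorphXn /= -nrmE -add_Re2_Im2; case: z => x y; simpc; congr (_ +i* _); ring.
Qed.

Lemma conjcR (t : R) : conjc t%:C = t%:C.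
Proof. exact: conjc_real. Qed.

Lemma nrm_conj z : nrm (conjc z) = nrm z.
Proof. by case: z => x y; rewrite /nrm !normc_def /= sqrrN. Qed.

End complex_modulus.

(** * Inner products, Bessel's inequality and Gram-Schmidt *)

Section inner_product.
Variables (R : realType) (V : hilbertType R).
Implicit Types x y : V.

Lemma nrmZ (c : R[i]) x : nrm (c *: x) = nrm c * nrm x.
Proof. by apply/complexI; rewrite rmorphM /= -!nrmE normrZ. Qed.

Lemma nrmZr (t : R) x : 0 <= t -> nrm (t%:C *: x) = t * nrm x.
Proof. by move=> t0; rewrite nrmZ nrmC ger0_norm. Qed.

Lemma inner0r x : inner x 0 = 0.
Proof. by rewrite -(scale0r 0) innerZr mul0r. Qed.

Lemma innerNr x y : inner x (- y) = - inner x y.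
Proof. by rewrite -scaleN1r innerZr mulN1r. Qed.

Lemma innerBr x y z : inner x (y - z) = inner x y - inner x z.
Proof. by rewrite innerDr innerNr. Qed.

Lemma inner_sumr x I (s : seq I) (P : pred I) (f : I -> V) :
  inner x (\sum_(i <- s | P i) f i) = \sum_(i <- s | P i) inner x (f i).
Proof.
elim/big_rec2: _ => [|i y z _ <-]; first exact: inner0r.
exact: innerDr.
Qed.

Lemma inner0l x : inner 0 x = 0.
Proof. by rewrite inner_conj inner0r conjc0. Qed.

Lemma innerDl x y z : inner (x + y) z = inner x z + inner y z.
Proof. by rewrite inner_conj innerDr rmorphD /= -!inner_conj. Qed.

Lemma innerZl (c : R[i]) x y : inner (c *: x) y = conjc c * inner x y.
Proof. by rewrite inner_conj innerZr rmorphM /= -!inner_conj. Qed.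

Lemma inner_suml x I (s : seq I) (P : pred I) (f : I -> V) :
  inner (\sum_(i <- s | P i) f i) x = \sum_(i <- s | P i) inner (f i) x.
Proof.
elim/big_rec2: _ => [|i y z _ <-]; first exact: inner0l.
exact: innerDl.
Qed.

Lemma inner_nrm x : inner x x = (nrm x ^+ 2)%:C.
Proof. by rewrite inner_norm nrmE rmorphXn. Qed.

Lemma inner_sym0 x y : inner x y = 0 -> inner y x = 0.
Proof. by move=> xy; rewrite inner_conj xy conjc0. Qed.

Lemma inner_ext x y : (forall z, inner z x = inner z y) -> x = y.
Proof.
move=> xy; apply/eqP; rewrite -subr_eq0; apply/eqP/nrm_eq0/eqP.
by rewrite -sqrf_eq0 -(inj_eq (@complexI R)) -inner_nrm innerBr xy subrr.
Qed.

Lemma nrm_sqrD x y : inner x y = 0 -> nrm (x + y) ^+ 2 = nrm x ^+ 2 + nrm y ^+ 2.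
Proof.
move=> xy; apply/complexI; rewrite rmorphD /= -!inner_nrm innerDl !innerDr.
by rewrite xy (inner_sym0 xy) addr0 add0r.
Qed.

Lemma nrm_sqr_sum n (x : 'I_n -> V) :
  (forall i j, i != j -> inner (x i) (x j) = 0) ->
  nrm (\sum_i x i) ^+ 2 = \sum_i nrm (x i) ^+ 2.
Proof.
move=> xx; apply/complexI; rewrite -inner_nrm rmorph_sum inner_suml.
apply: eq_bigr => i _; rewrite inner_sumr (bigD1 i) //= big1 ?addr0 ?inner_nrm//.
by move=> j ji; rewrite xx // eq_sym.
Qed.

(* The vectors [u 0, ..., u (n - 1)] form an orthonormal system, except that some
   of them may vanish: this lets Gram-Schmidt act without case distinction. *)
Definition orthosystem n (u : nat -> V) :=
  (forall i j, (i < n)%N -> (j < n)%N -> i <> j -> inner (u i) (u j) = 0) /\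
  (forall i, (i < n)%N -> inner (u i) (u i) *: u i = u i).

Definition proj n (u : nat -> V) x := \sum_(i < n) inner (u i) x *: u i.

Section orthosystem_theory.
Variables (n : nat) (u : nat -> V).
Hypothesis hu : orthosystem n u.

Lemma orthosystem_inner i x : (i < n)%N ->
  inner (u i) (proj n u x) = inner (u i) x.
Proof.
move=> ni; rewrite inner_sumr (bigD1 (Ordinal ni)) //= big1 ?addr0.
  (* The second condition of an orthosystem absorbs the factor [inner (u i) (u i)], whether it is 0
     or 1. *)
  by rewrite innerZr mulrC -[in RHS](hu.2 _ ni) innerZl inner_nrm conjcR.
move=> j /eqP ji; rewrite innerZr hu.1 ?mulr0 // => ij; apply: ji.
by apply/val_inj; rewrite /= ij.
Qed.

Lemma proj_compl i x : (i < n)%N -> inner (u i) (x - proj n u x) = 0.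
Proof. by move=> ni; rewrite innerBr orthosystem_inner ?subrr. Qed.

Lemma proj_orth x y : (forall i, (i < n)%N -> inner (u i) y = 0) ->
  inner (proj n u x) y = 0.
Proof.
by move=> uy; rewrite inner_suml big1 // => i _; rewrite innerZl uy ?mulr0.
Qed.

Lemma nrm_proj x : nrm (proj n u x) ^+ 2 = \sum_(i < n) nrm (inner (u i) x) ^+ 2.
Proof.
apply/complexI; rewrite -inner_nrm {1}/proj inner_suml rmorph_sum /=.
by apply: eq_bigr => i _; rewrite innerZl orthosystem_inner // conjcM.
Qed.

Lemma proj_pythagoras x :
  nrm x ^+ 2 = nrm (proj n u x) ^+ 2 + nrm (x - proj n u x) ^+ 2.
Proof.
rewrite -nrm_sqrD ?subrKC // proj_orth // => i ni; exact: proj_compl.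
Qed.

Lemma nrm_projC x : nrm (x - proj n u x) <= nrm x.
Proof.
rewrite -(@ler_pXn2r _ 2) ?nnegrE ?nrm_ge0 // (proj_pythagoras x).
by rewrite lerDr sqr_ge0.
Qed.

Lemma bessel x : \sum_(i < n) nrm (inner (u i) x) ^+ 2 <= nrm x ^+ 2.
Proof. by rewrite -nrm_proj (proj_pythagoras x) lerDl sqr_ge0. Qed.

End orthosystem_theory.

Lemma unit_vector x : x != 0 -> nrm ((nrm x)^-1%:C *: x) = 1.
Proof.
move=> x0; rewrite nrmZr ?invr_ge0 ?nrm_ge0 // mulVf //.
by apply: contra x0 => /eqP/nrm_eq0 ->.
Qed.

(** Bessel's inequality for the system that consists of the normalized [x] alone. *)
Lemma cauchy_schwarz x y : nrm (inner x y) <= nrm x * nrm y.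
Proof.
have [->|x0] := eqVneq x 0; first by rewrite inner0l !nrm0 mul0r.
pose u (i : nat) := (nrm x)^-1%:C *: x.
have u1 : nrm (u 0%N) = 1 := unit_vector x0.
have hu : orthosystem 1 u.
  split=> [[|i] [|j]//|i _].
  by rewrite inner_nrm [nrm _]u1 expr1n scale1r.
have xE : x = (nrm x)%:C *: u 0%N.
  rewrite scalerA -rmorphM /= mulfV ?rmorph1 ?scale1r //.
  by apply: contra x0 => /eqP/nrm_eq0 ->.
have := bessel hu y; rewrite big_ord1 ler_pXn2r ?nnegrE ?nrm_ge0 // => h.
rewrite [X in nrm (inner X _)]xE innerZl conjcR nrmM nrmC.
by rewrite ger0_norm ?nrm_ge0 // ler_wpM2l ?nrm_ge0.
Qed.

Definition extend n (u : nat -> V) x := fun i => if (i < n)%N then u i else x.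

Lemma extend_lt n u x i : (i < n)%N -> extend n u x i = u i.
Proof. by rewrite /extend => ->. Qed.

Lemma extend_last n u x : extend n u x n = x.
Proof. by rewrite /extend ltnn. Qed.

Lemma orthosystem_extend n u x : orthosystem n u ->
  (forall i, (i < n)%N -> inner (u i) x = 0) -> inner x x *: x = x ->
  orthosystem n.+1 (extend n u x).
Proof.
move=> hu ux xx.
have lt_cases i : (i < n.+1)%N -> (i < n)%N \/ i = n.
  by rewrite ltnS leq_eqVlt => /orP[/eqP|]; [right|left].
split=> [i j /lt_cases[ni|->] /lt_cases[nj|->] ij|i /lt_cases[ni|->]].
- by rewrite !extend_lt //; apply: hu.1.
- by rewrite extend_lt // extend_last ux.
- by apply/inner_sym0; rewrite extend_lt // extend_last ux.
- by case: ij.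
- by rewrite extend_lt //; apply: hu.2.
- by rewrite extend_last.
Qed.

Lemma gram_schmidt1 n u x : orthosystem n u ->
  exists v, [/\ forall i, (i < n)%N -> v i = u i, orthosystem n.+1 v &
    proj n.+1 v x = x].
Proof.
(* If [x] already lies in the span, then [y] and [z] vanish, which an orthosystem permits. *)
move=> hu; pose y := x - proj n u x; pose z := (nrm y)^-1%:C *: y.
have uy i : (i < n)%N -> inner (u i) y = 0 by exact: proj_compl.
exists (extend n u z); split=> [i||]; first exact: extend_lt.
  apply: orthosystem_extend => // [i ni|]; first by rewrite innerZr uy ?mulr0.
  rewrite /z; have [->|y0] := eqVneq y 0; first by rewrite !scaler0.
  by rewrite inner_nrm unit_vector // expr1n scale1r.
rewrite /proj big_ord_recr /= (eq_bigr (fun i : 'I_n => inner (u i) x *: u i)); last first.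
  by move=> i _; rewrite extend_lt.
rewrite -/(proj n u x) -[RHS](subrKC (proj n u x)) -/y; congr (_ + _).
rewrite extend_last.
have -> : inner z x = inner z y.
  rewrite innerBr innerZl innerZl (inner_sym0 (proj_orth _ uy)).
  by rewrite mulr0 subr0.
rewrite /z; have [y0|y0] := eqVneq y 0; first by rewrite y0 !scaler0.
rewrite innerZl conjcR inner_nrm scalerA -!rmorphM /=.
have n0 : nrm y != 0 by apply: contra y0 => /eqP/nrm_eq0 ->.
rewrite (_ : _ * _ = 1) ?scale1r //.
by rewrite expr2 mulKf // mulfV.
Qed.

(** A vector in the span of the first [n] members is orthogonal to all later ones, so these add
    nothing to its projection. *)
Lemma proj_extend n m u v x : (n <= m)%N -> orthosystem m v ->
  (forall i, (i < n)%N -> v i = u i) -> proj n u x = x -> proj m v x = x.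
Proof.
move=> nm hv vu ux.
rewrite /proj -(big_mkord xpredT (fun i => inner (v i) x *: v i)).
rewrite (big_cat_nat (n := n)) //= [X in _ + X](_ : _ = 0) ?addr0.
  by rewrite big_mkord -[RHS]ux; apply: eq_bigr => i _; rewrite vu.
rewrite big_nat_cond big1 // => i; rewrite andbT => /andP[ni im].
rewrite -ux inner_sumr big1 ?scale0r // => j _.
rewrite innerZr -vu // hv.1 ?mulr0 //; first exact: leq_trans nm.
by move=> ij; move: ni; rewrite ij leqNgt ltn_ord.
Qed.

(** Keeping the given [u] as an initial segment is the point: a sum of squares over [u] is later
    compared with the sum over a system large enough to span [s]. *)
Lemma gram_schmidt n u (s : seq V) : orthosystem n u ->
  exists m v, [/\ (n <= m)%N, forall i, (i < n)%N -> v i = u i,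
    orthosystem m v & forall x, List.In x s -> proj m v x = x].
Proof.
elim: s => [|x s ih] hu; first by exists n, u.
have [m [v [nm vu hv vs]]] := ih hu.
have [w [wv hw wx]] := gram_schmidt1 x hv.
exists m.+1, w; split=> // [|i ni|y [<-//|ys]]; first exact: leqW.
  by rewrite wv ?vu //; exact: leq_trans nm.
by apply: proj_extend (vs _ ys); rewrite ?leqnSn.
Qed.

End inner_product.

(** * Topology in terms of the real norm; linear spans and their closures *)

Section metric_topology.
Variables (R : realType) (V : hilbertType R).
Implicit Types (x y : V) (S : set V).

Lemma pos_real_part (e : R[i]) : 0 < e -> e = (complex.Re e)%:C /\ 0 < complex.Re e.
Proof.
by case: e => a b; rewrite ltcE /= => /andP[/eqP -> a0].
Qed.

Lemma nbhs_nrm x S :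
  nbhs x S <-> exists2 e : R, 0 < e & forall y, nrm (x - y) < e -> S y.
Proof.
split=> [/nbhs_normP[e /= /pos_real_part[-> e0] eS]|[e e0 eS]].
  by exists (complex.Re e) => // y xy; apply: eS => /=; rewrite /ball_ /= nrmE ltcR.
apply/nbhs_normP; exists e%:C; first by rewrite /= ltcR.
by move=> y; rewrite /ball_ /= nrmE ltcR => /eS.
Qed.

Lemma closure_nrm S x :
  closure S x <-> forall e : R, 0 < e -> exists2 y, S y & nrm (x - y) < e.
Proof.
split=> [cS e e0|Sx B /nbhs_nrm[e e0 eB]].
  have /cS[y [Sy xy]] : nbhs x [set y | nrm (x - y) < e] by apply/nbhs_nrm; exists e.
  by exists y.
by have [y Sy /eB] := Sx _ e0; exists y.
Qed.

Lemma dense_nrm S x (e : R) : dense S -> 0 < e -> exists2 y, S y & nrm (x - y) < e.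
Proof.
move=> dS e0; pose U := [set y | nrm (x - y) < e].
have [|y [/interior_subset Uy Sy]] := dS (interior U) _ (@open_interior _ U).
  by exists x; apply/nbhs_nrm; exists e.
by exists y.
Qed.

Lemma cvg_nrmP (u : nat -> V) (l : V) :
  u @ \oo --> l <->
  forall e : R, 0 < e -> exists N, forall n, (N <= n)%N -> nrm (l - u n) < e.
Proof.
split=> [ul e e0|ul].
  have /ul[N _ NU] : nbhs l [set y | nrm (l - y) < e] by apply/nbhs_nrm; exists e.
  by exists N => n Nn; apply: NU.
apply/cvgrPdist_lt => e /pos_real_part[-> /ul[N NU]].
by exists N => // n Nn /=; rewrite nrmE ltcR; apply: NU.
Qed.

Lemma cauchy_nrm (u : nat -> V) :
  (forall e : R, 0 < e -> exists N, forall m n, (N <= m)%N -> (m <= n)%N ->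
    nrm (u n - u m) < e) -> exists l : V, u @ \oo --> l.
Proof.
move=> cu; suff : cvgn u by move=> cv; exists (limn u).
apply: cauchy_cvg; apply: cauchy_exP => e /pos_real_part[eE /cu[N NU]].
exists (u N); exists N => // n Nn /=.
by rewrite -ball_normE /ball_ /= nrmE [X in _ < X]eE ltcR nrmB; apply: NU.
Qed.

Lemma lim_nrm_le (u : nat -> V) (l : V) (C : R) : u @ \oo --> l ->
  (forall e : R, 0 < e -> exists N, forall n, (N <= n)%N -> nrm (u n) <= C + e) ->
  nrm l <= C.
Proof.
move=> /cvg_nrmP ul uC; apply/ler_addgt0Pr => e e0.
have e2 : 0 < e / 2 by rewrite divr_gt0.
have [N Nl] := ul _ e2; have [M MC] := uC _ e2.
have := Nl (maxn N M) (leq_maxl _ _); have := MC (maxn N M) (leq_maxr _ _).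
have := nrm_leD l (u (maxn N M)); lra.
Qed.

End metric_topology.

Section span.
Variables (R : realType) (V : hilbertType R) (S : set V).

Lemma lspan_sub x : S x -> lspan S x.
Proof.
by move=> Sx; exists 1%N, (fun=> 1), (fun=> x); split=> //; rewrite big_ord1 scale1r.
Qed.

Lemma lspan0 : lspan S 0.
Proof. by exists 0%N, (fun=> 0), (fun=> 0); split=> [[]//|]; rewrite big_ord0. Qed.

Lemma lspanZ (c : R[i]) x : lspan S x -> lspan S (c *: x).
Proof.
move=> [n [d [v [vS ->]]]]; exists n, (fun i => c * d i), v; split=> //.
by rewrite scaler_sumr; apply: eq_bigr => i _; rewrite scalerA.
Qed.

Lemma lspanD x y : lspan S x -> lspan S y -> lspan S (x + y).
Proof.
move=> [n [c [v [vS ->]]]] [m [d [w [wS ->]]]].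
exists (n + m)%N,
  (fun i : 'I_(n + m) => match fintype.split i with inl j => c j | inr k => d k end),
  (fun i : 'I_(n + m) => match fintype.split i with inl j => v j | inr k => w k end); split.
  by move=> i; case: fintype.split.
rewrite big_split_ord /=; congr (_ + _); apply: eq_bigr => i _.
  by rewrite (unsplitK (inl i)).
by rewrite (unsplitK (inr i)).
Qed.

Lemma lspan_ind (P : V -> Prop) : P 0 -> (forall x y, P x -> P y -> P (x + y)) ->
  (forall (c : R[i]) x, P x -> P (c *: x)) -> (forall x, S x -> P x) ->
  forall x, lspan S x -> P x.
Proof.
move=> P0 PD PZ PS x [n [c [v [vS ->]]]].
by elim/big_ind: _ => // i _; apply/PZ/PS.
Qed.

Lemma closure_lspan0 : closure (lspan S) 0.
Proof. by apply: subset_closure; exact: lspan0. Qed.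

Lemma closure_lspanZ (c : R[i]) x : closure (lspan S) x -> closure (lspan S) (c *: x).
Proof.
move=> /closure_nrm Sx; apply/closure_nrm => e e0.
have c1 : 0 < nrm c + 1 by rewrite ltr_wpDl ?nrm_ge0.
have [y Sy xy] := Sx (e / (nrm c + 1)) (divr_gt0 e0 c1).
exists (c *: y); first exact: lspanZ.
rewrite -scalerBr nrmZ; move: xy; rewrite ltr_pdivlMr // mulrC.
by apply: le_lt_trans; rewrite ler_wpM2r ?nrm_ge0 // lerDl.
Qed.

Lemma closure_lspanD x y : closure (lspan S) x -> closure (lspan S) y ->
  closure (lspan S) (x + y).
Proof.
move=> /closure_nrm Sx /closure_nrm Sy; apply/closure_nrm => e e0.
have e2 : 0 < e / 2 by rewrite divr_gt0.
have [z Sz xz] := Sx _ e2; have [w Sw yw] := Sy _ e2.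
exists (z + w); first exact: lspanD.
rewrite opprD addrACA; have := nrmD (x - z) (y - w); lra.
Qed.

End span.

(** * Conjugations, and limit arguments by epsilon *)

Section conjugation_theory.
Variables (R : realType) (L : hilbertType R) (J : L -> L).
Hypothesis hJ : conjugation J.

Lemma conjugationD f g : J (f + g) = J f + J g.
Proof. by case: hJ. Qed.

Lemma conjugationZ (c : R[i]) f : J (c *: f) = conjc c *: J f.
Proof. by case: hJ => _ ->. Qed.

Lemma conjugation0 : J 0 = 0.
Proof. by apply: (addrI (J 0)); rewrite -conjugationD !addr0. Qed.

Lemma conjugationK f : J (J f) = f.
Proof. by case: hJ => _ _ _; exact. Qed.

Lemma nrm_conjugation f : nrm (J f) = nrm f.
Proof. by case: hJ => _ _ h _; rewrite /nrm h. Qed.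

Lemma conjugationN f : J (- f) = - J f.
Proof. by rewrite -scaleN1r conjugationZ rmorphN1 scaleN1r. Qed.

Lemma Re_inner (f g : L) :
  complex.Re (inner f g) = (nrm (f + g) ^+ 2 - nrm f ^+ 2 - nrm g ^+ 2) / 2.
Proof.
have : (nrm (f + g) ^+ 2)%:C = (nrm f ^+ 2)%:C + (nrm g ^+ 2)%:C +
    (inner f g + conjc (inner f g)).
  by rewrite -!inner_nrm innerDl !innerDr -inner_conj addrACA addrA -!addrA; ring.
case: (inner f g) => a b /(congr1 (@complex.Re R)) /=.
by move=> ->; field.
Qed.

(** Polarization carries the isometry of [J] over to real parts of inner products. Applied to [i g]
    it gives the imaginary parts, whose sign flips by antilinearity; hence the exchanged
    arguments. *)
Lemma inner_conjugation f g : inner (J f) (J g) = inner g f.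
Proof.
have ReJ x y : complex.Re (inner (J x) (J y)) = complex.Re (inner x y).
  by rewrite !Re_inner -conjugationD !nrm_conjugation.
have ImE (z : R[i]) : complex.Im z = - complex.Re ('i%C * z).
  by case: z => x y; simpc => /=.
rewrite [RHS]inner_conj.
have := ReJ f ('i%C *: g); rewrite conjugationZ !innerZr.
have := ReJ f g.
case: (inner (J f) (J g)) (inner f g) => [a b] [c d] /=.
by move=> -> h; congr (_ +i* _); lra.
Qed.

End conjugation_theory.

(** The restriction [e <= 1] lets quadratic errors be absorbed into the linear term [e * k]. *)
Lemma le_of_le_eps (R : realType) (c C k : R) :
  (forall e, 0 < e <= 1 -> c <= C + e * k) -> c <= C.
Proof.
move=> h; apply/ler_addgt0Pr => e e0.
have k1 : 0 < `|k| + 1 by rewrite ltr_wpDl.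
pose d := Num.min 1 (e / (`|k| + 1)).
have d0 : 0 < d by rewrite lt_min ltr01 divr_gt0.
have d1 : d <= 1 by rewrite ge_min lexx.
have de : d * (`|k| + 1) <= e by rewrite -ler_pdivlMr // ge_min lexx orbT.
have kk : d * k <= d * (`|k| + 1).
  by rewrite ler_wpM2l ?(ltW d0) // (le_trans (ler_norm k)) // lerDl.
have := h d; rewrite d0 d1 => /(_ isT); lra.
Qed.

Section closure_orthogonality.
Variables (R : realType) (V : hilbertType R).

Lemma closure_inner0 (S : set V) y : (forall x, S x -> inner x y = 0) ->
  forall x, closure S x -> inner x y = 0.
Proof.
move=> Sy x /closure_nrm cx; apply: nrm_eq0; apply/eqP.
rewrite eq_le nrm_ge0 andbT; apply: (@le_of_le_eps _ _ _ (nrm y)) => e /andP[e0 _].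
have [z Sz xz] := cx _ e0; rewrite add0r.
rewrite -[x](subrK z) innerDl (Sy _ Sz) addr0.
rewrite (le_trans (cauchy_schwarz _ _)) // ler_wpM2r ?nrm_ge0 //; exact: ltW.
Qed.

Lemma orthosystem_le1 n u i : orthosystem n u -> (i < n)%N -> nrm (u i : V) <= 1.
Proof.
move=> [_ u1] ni; have := congr1 (@nrm _ _) (u1 i ni).
rewrite inner_nrm nrmZr ?sqr_ge0 //; have := nrm_ge0 (u i).
rewrite le_eqVlt => /orP[/eqP <-//|u0].
by move=> /(canRL (mulfK (lt0r_neq0 u0))); rewrite mulfV ?lt0r_neq0 // => h; nra.
Qed.

End closure_orthogonality.

(** * Fock space: operator bounds, grading and the number operator *)

Section fock_theory.
Variables (R : realType) (L F : hilbertType R) (J : L -> L).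
Variables (a adag : L -> {linear F -> F}) (Omega : F).
Hypotheses (hJ : conjugation J) (hF : fock_representation J a adag Omega).

Local Notation pvec := (particle_vector adag Omega).
Local Notation pvecs n := [set pvec fs | fs in [set fs | size fs = n]].
Local Notation pspan n := (lspan (pvecs n)).
Local Notation pspace := (particle_space adag Omega).

Lemma fock_a0 x : a 0 x = 0.
Proof.
by have := fock_a_linear hF (-1) 0 0 x; rewrite scaler0 addr0 scaleN1r addNr.
Qed.

Lemma fock_aZ (c : R[i]) f x : a (c *: f) x = c *: a f x.
Proof. by rewrite -[c *: f]addr0 (fock_a_linear hF) fock_a0 addr0. Qed.

Lemma fock_aD f g x : a (f + g) x = a f x + a g x.
Proof. by rewrite -{1}[f]scale1r (fock_a_linear hF) scale1r. Qed.

Lemma fock_aB f g x : a (f - g) x = a f x - a g x.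
Proof. by rewrite -scaleN1r addrC (fock_a_linear hF) scaleN1r addrC. Qed.

Lemma fock_a_sum I (s : seq I) (P : pred I) (f : I -> L) x :
  a (\sum_(i <- s | P i) f i) x = \sum_(i <- s | P i) a (f i) x.
Proof.
elim/big_rec2: _ => [|i y z _ <-]; first exact: fock_a0.
exact: fock_aD.
Qed.

Lemma fock_adag0 x : adag 0 x = 0.
Proof.
by have := fock_adag_linear hF (-1) 0 0 x; rewrite scaler0 addr0 scaleN1r addNr.
Qed.

Lemma fock_adag_sum n (c : 'I_n -> R[i]) (f : 'I_n -> L) x :
  adag (\sum_i c i *: f i) x = \sum_i c i *: adag (f i) x.
Proof.
elim/big_rec2: _ => [|i y z _ <-]; first exact: fock_adag0.
by rewrite (fock_adag_linear hF).
Qed.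

Lemma fock_adjoint_r f x y : inner (adag (J f) x) y = inner x (a f y).
Proof. by rewrite inner_conj -(fock_adjoint hF) -inner_conj. Qed.

Lemma fock_adag_adj f x y : inner (adag f x) y = inner x (a (J f) y).
Proof. by rewrite -fock_adjoint_r (conjugationK hJ). Qed.

(** With the operators moved to the second argument, the left side is the expectation in [x] of the
    anticommutator of [a f] and [adag (J f)], which is the scalar [|f|^2]. Dropping either square
    bounds the other operator by [|f|]. *)
Lemma nrm_fock f x :
  nrm (a f x) ^+ 2 + nrm (adag (J f) x) ^+ 2 = nrm f ^+ 2 * nrm x ^+ 2.
Proof.
apply/complexI; rewrite rmorphD [RHS]rmorphM /= -!inner_nrm.
rewrite (fock_adjoint hF) fock_adjoint_r -innerDr addrC (fock_aadag hF).
by rewrite innerZr (inner_conjugation hJ).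
Qed.

Lemma nrm_fock_a f x : nrm (a f x) <= nrm f * nrm x.
Proof.
rewrite -(@ler_pXn2r _ 2) ?nnegrE ?mulr_ge0 ?nrm_ge0 // exprMn -nrm_fock.
by rewrite lerDl sqr_ge0.
Qed.

Lemma pspan_adag n f x : pspan n x -> pspan n.+1 (adag f x).
Proof.
move: x; apply: lspan_ind => [|x y px py|c x px|x [fs /= sz <-]].
- by rewrite linear0; exact: lspan0.
- by rewrite linearD; exact: lspanD.
- by rewrite linearZ; exact: lspanZ.
- by apply: lspan_sub; exists (f :: fs) => //=; rewrite sz.
Qed.

Lemma pspan_a0 f x : pspan 0 x -> a f x = 0.
Proof.
move: x; apply: lspan_ind => [|x y px py|c x px|x [[] //= _ <-]].
- by rewrite linear0.
- by rewrite linearD px py addr0.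
- by rewrite linearZ /= px scaler0.
- exact: fock_vacuum hF f.
Qed.

(** Anticommuting [a f] past the outermost creation operator leaves a scalar multiple of the
    remaining vector and a term to which the induction applies. *)
Lemma pspan_a n f x : pspan n.+1 x -> pspan n (a f x).
Proof.
elim: n f x => [|n ih] f; apply: lspan_ind => [|x y px py|c x px|x].
- by rewrite linear0; exact: lspan0.
- by rewrite linearD; exact: lspanD.
- by rewrite linearZ; exact: lspanZ.
- move=> [[|g [|//]] //= _ <-]; have := fock_aadag hF f g Omega.
  rewrite (fock_vacuum hF) linear0 addr0 => ->.
  by apply/lspanZ/lspan_sub; exists [::].
- by rewrite linear0; exact: lspan0.
- by rewrite linearD; exact: lspanD.
- by rewrite linearZ; exact: lspanZ.
- move=> [[//|g fs] /= [sz] <-].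
  have := fock_aadag hF f g (pvec fs) => /(canRL (addrK _)) ->.
  have pfs : pspan n.+1 (pvec fs) by apply: lspan_sub; exists fs.
  apply: lspanD; first exact: lspanZ.
  by rewrite -scaleN1r; apply/lspanZ/pspan_adag/ih.
Qed.

(** The outermost creation operator of [y] passes to [x] as an annihilation operator, which lowers
    both particle numbers by one. The smaller one runs out first, and then annihilation gives
    zero. *)
Lemma pspan_orth p q x y : (p < q)%N -> pspan p x -> pspan q y -> inner y x = 0.
Proof.
elim: p q x y => [|p ih] [//|q] x y pq px; move: y; apply: lspan_ind => [|y z hy hz|c y hy|].
- exact: inner0l.
- by rewrite innerDl hy hz addr0.
- by rewrite innerZl hy mulr0.
- by move=> y [[|g fs] //= _ <-]; rewrite fock_adag_adj (pspan_a0 _ px) inner0r.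
- exact: inner0l.
- by rewrite innerDl hy hz addr0.
- by rewrite innerZl hy mulr0.
- move=> y [[//|g fs] /= [sz] <-]; rewrite fock_adag_adj (ih q) //.
    exact: pspan_a.
  by apply: lspan_sub; exists fs.
Qed.

Lemma pspace_orth p q x y : p <> q -> pspace p x -> pspace q y -> inner x y = 0.
Proof.
wlog pq : p q x y / (q < p)%N => [hwlog /eqP|].
  rewrite neq_ltn => /orP[] pq px qy; first apply/inner_sym0.
    by apply: (hwlog q p); rewrite //; apply/eqP; rewrite gtn_eqF.
  by apply: (hwlog p q); rewrite //; apply/eqP; rewrite gtn_eqF.
move=> _ px qy; apply: closure_inner0 px => z pz.
apply/inner_sym0; apply: closure_inner0 qy => w qw.
by apply/inner_sym0; exact: pspan_orth pq qw pz.
Qed.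

Lemma pspace_a n f x : pspace n.+1 x -> pspace n (a f x).
Proof.
move=> /closure_nrm cx; apply/closure_nrm => e e0.
have f1 : 0 < nrm f + 1 by rewrite ltr_wpDl ?nrm_ge0.
have [y Sy xy] := cx (e / (nrm f + 1)) (divr_gt0 e0 f1).
exists (a f y); first exact: pspan_a.
rewrite -linearB; apply: le_lt_trans (nrm_fock_a _ _) _.
move: xy; rewrite ltr_pdivlMr // mulrC; apply: le_lt_trans.
by rewrite ler_wpM2r ?nrm_ge0 // lerDl.
Qed.

Lemma pspace_a0 f x : pspace 0 x -> a f x = 0.
Proof.
move=> /closure_nrm cx; apply: nrm_eq0; apply/eqP; rewrite eq_le nrm_ge0 andbT.
apply: (@le_of_le_eps _ _ _ (nrm f)) => e /andP[e0 _].
have [y Sy xy] := cx _ e0.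
rewrite add0r -[x](subrK y) linearD (pspan_a0 _ Sy) addr0.
rewrite (le_trans (nrm_fock_a _ _)) // mulrC ler_wpM2r ?nrm_ge0 //; exact: ltW.
Qed.

(** The commutator of the truncated number operator with [adag f] is [adag (proj m v f)], which is
    [adag f] when [f] lies in the span of [v]. Each creation operator therefore contributes exactly
    1. *)
Lemma number_pvec m v fs : orthosystem m v ->
  (forall f, List.In f fs -> proj m v f = f) ->
  \sum_(i < m) adag (v i) (a (J (v i)) (pvec fs)) = (size fs)%:R *: pvec fs.
Proof.
move=> hv; elim: fs => [|f fs ih] vfs /=.
  by rewrite scale0r big1 // => i _; rewrite (fock_vacuum hF) linear0.
under eq_bigr => i _.
  have := fock_aadag hF (J (v i)) f (pvec fs) => /(canRL (addrK _)) ->.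
  rewrite (conjugationK hJ) linearB linearZ /=.
  have := fock_adagadag hF (v i) f (a (J (v i)) (pvec fs)) => /(canRL (addrK _)) ->.
  rewrite sub0r opprK.
  over.
rewrite big_split /= -linear_sum ih; last by move=> g gfs; apply: vfs; right.
rewrite linearZ /= -fock_adag_sum -/(proj m v f) vfs; last by left.
by rewrite -[X in X + _]scale1r -scalerDl nat1r.
Qed.

(** Extend [u] to a system [v] that spans every one-particle vector occurring in [y]. For [v] the
    sum equals [p |y|^2], and the sum over [u] is a part of it. *)
Lemma number_pspan p n u y : orthosystem n u -> pspan p y ->
  \sum_(i < n) nrm (a (J (u i)) y) ^+ 2 <= p%:R * nrm y ^+ 2.
Proof.
move=> hu [k [c [w [wS yE]]]].
have [fs fsp fsw] := fin_all_exists2 wS.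
have [m [v [nm vu hv vfs]]] := gram_schmidt (flatten [seq fs i | i <- enum 'I_k]) hu.
have fsv i f : List.In f (fs i) -> proj m v f = f.
  move=> ffs; apply: vfs.
  have: i \in enum 'I_k by rewrite mem_enum.
  elim: (enum 'I_k) => //= j s ih; rewrite inE => /orP[/eqP <-|/ih].
    by apply/List.in_or_app; left.
  by move=> ?; apply/List.in_or_app; right.
have Ny : \sum_(i < m) adag (v i) (a (J (v i)) y) = p%:R *: y.
  rewrite yE; under eq_bigr do rewrite linear_sum /= linear_sum.
  rewrite exchange_big scaler_sumr; apply: eq_bigr => i _ /=.
  under eq_bigr do rewrite linearZ /= linearZ /=.
  rewrite -scaler_sumr -[w i]fsw (number_pvec hv (fsv i)) fsp.
  by rewrite !scalerA mulrC.
have NE : \sum_(i < m) nrm (a (J (v i)) y) ^+ 2 = p%:R * nrm y ^+ 2.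
  apply/complexI; rewrite [RHS]rmorphM /= -inner_nrm rmorph_nat -innerZr -Ny.
  rewrite inner_sumr rmorph_sum; apply: eq_bigr => i _ /=.
  by rewrite -inner_nrm (fock_adjoint hF) (conjugationK hJ).
rewrite -NE -!(big_mkord xpredT (fun i => nrm (a (J (_ i)) y) ^+ 2)).
rewrite (big_cat_nat (n := n) (p := m)) //=.
rewrite (eq_big_nat _ _ (F2 := fun i => nrm (a (J (v i)) y) ^+ 2)); last first.
  by move=> i /andP[_ ni]; rewrite vu.
by rewrite lerDl; apply: sumr_ge0 => i _; exact: sqr_ge0.
Qed.

Lemma number_pspace p n u x : orthosystem n u -> pspace p x ->
  \sum_(i < n) nrm (a (J (u i)) x) ^+ 2 <= p%:R * nrm x ^+ 2.
Proof.
move=> hu /closure_nrm cx.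
(* Both constants come from [(b + e)^2 <= b^2 + e (2 b + 1)] for [e <= 1]: with [b = |x|] when [|y|]
   is compared with [|x|], and in each of the [n] terms with [b = |a(J u_i) y| <= |x| + 1]. *)
apply: (@le_of_le_eps _ _ _ (p%:R * (2 * nrm x + 1) + n%:R * (2 * (nrm x + 1) + 1))).
move=> e /andP[e0 e1]; have [y Sy xy] := cx _ e0.
have yx : nrm y <= nrm x + e.
  by rewrite (le_trans (nrm_leD y x)) // lerD2l nrmB ltW.
have y0 := nrm_ge0 y; have x0 := nrm_ge0 x.
have step (i : 'I_n) : nrm (a (J (u i)) x) ^+ 2 <=
    nrm (a (J (u i)) y) ^+ 2 + e * (2 * (nrm x + 1) + 1).
  have u1 := orthosystem_le1 hu (ltn_ord i); have u0 := nrm_ge0 (u i).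
  have h1 : nrm (a (J (u i)) x) <= nrm (a (J (u i)) y) + e.
    apply: le_trans (nrm_leD _ (a (J (u i)) y)) _; rewrite lerD2l -linearB.
    apply: le_trans (nrm_fock_a _ _) _; rewrite (nrm_conjugation hJ).
    by have := nrm_ge0 (x - y); nra.
  have h2 : nrm (a (J (u i)) y) <= nrm x + 1.
    apply: le_trans (nrm_fock_a _ _) _; rewrite (nrm_conjugation hJ); nra.
  by have := nrm_ge0 (a (J (u i)) x); have := nrm_ge0 (a (J (u i)) y); nra.
apply: le_trans (ler_sum _ (fun i _ => step i)) _.
rewrite big_split /= sumr_const card_ord -mulr_natl.
have := number_pspan hu Sy => h; have p0 : 0 <= p%:R :> R by [].
have : p%:R * nrm y ^+ 2 <= p%:R * nrm x ^+ 2 + e * (p%:R * (2 * nrm x + 1)).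
  rewrite [e * _]mulrCA -mulrDr ler_wpM2l //; nra.
lra.
Qed.

End fock_theory.

(** * Archimedean bounds and compact operators *)

Section real_facts.
Variable R : realType.

Lemma nat_above (x : R) : exists n : nat, x < n%:R.
Proof.
exists (Num.bound `|x|); apply: le_lt_trans (ler_norm x) _.
exact: archi_boundP.
Qed.

Lemma inv_nat_below (d : R) : 0 < d ->
  exists N : nat, forall k, (N <= k)%N -> k.+1%:R^-1 < d.
Proof.
move=> d0; have [N Nd] := nat_above d^-1; exists N => k Nk.
rewrite -[d]invrK ltf_pV2 ?posrE ?invr_gt0 ?ltr0Sn //.
by apply: lt_le_trans Nd _; rewrite ler_nat leqW.
Qed.

End real_facts.

Section compact_operators.
Variables (R : realType) (L : hilbertType R) (A : {linear L -> L}).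
Hypothesis cA : compact_operator A.

(** A cluster point of the image sequence, approached at arbitrarily late indices, takes the place
    of the limit of a convergent subsequence. *)
Lemma compact_operator_cluster (x : nat -> L) : (forall k, nrm (x k) <= 1) ->
  exists y, forall e : R, 0 < e -> forall N, exists2 k, (N <= k)%N &
    nrm (A (x k) - y) < e.
Proof.
move=> x1; have := cA; rewrite /compact_operator precompactE => cc.
have [|y [_ cy]] := cc ((fun k => A (x k)) @ \oo) _.
  exists 0%N => // k _; apply: subset_closure; exists (x k) => //=.
  by rewrite nrmE -[1]/(1%:C) lecR.
exists y => e e0 N.
have /(_ [set A (x k) | k in [set k | (N <= k)%N]]) := cy^~ [set z | nrm (y - z) < e].
case; last by move=> z [[k Nk <-] yk]; exists k => //; rewrite nrmB.
  by exists N => // k Nk; exists k.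
by apply/nbhs_nrm; exists e.
Qed.

(** Otherwise there are vectors [x k] of the unit ball with [|A (x k)| > k], and their images would
    still cluster at a point of finite norm. *)
Lemma compact_operator_bounded :
  exists2 M, 1 <= M & forall x, nrm (A x) <= M * nrm x.
Proof.
apply: contrapT => hM.
have /choice[x xk] : forall k : nat, exists x, nrm x <= 1 /\ k%:R < nrm (A x).
  move=> k; apply: contrapT => hk; apply: hM; exists (k%:R + 1); first by rewrite lerDr.
  move=> x; have [->|x0] := eqVneq x 0; first by rewrite linear0 !nrm0 mulr0.
  have x0' : 0 < nrm x.
    by rewrite lt_def nrm_ge0 andbT; apply: contra x0 => /eqP/nrm_eq0 ->.
  rewrite leNgt; apply/negP => h; apply: hk.
  exists ((nrm x)^-1%:C *: x); split; first by rewrite unit_vector.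
  rewrite linearZ nrmZr ?invr_ge0 ?nrm_ge0 // ltr_pdivlMl // mulrC.
  apply: le_lt_trans h; rewrite ler_wpM2r ?nrm_ge0 // lerDl//.
have [|y ycl] := @compact_operator_cluster x; first by move=> k; case: (xk k).
have [N Ny] := nat_above (nrm y + 1).
have [k Nk kl] := ycl 1 ltr01 N.
have [_ kA] := xk k; have := nrm_leD (A (x k)) y.
have : (N%:R : R) <= k%:R by rewrite ler_nat.
lra.
Qed.

End compact_operators.

(** * Adjoints, and the norm attained by a compact operator *)

Section adjoint_theory.
Variables (R : realType) (L : hilbertType R) (A : {linear L -> L}) (B : L -> L).
Hypothesis AB : is_adjoint A B.

Lemma adjoint_sym x y : inner (B x) y = inner x (A y).
Proof. by rewrite inner_conj -AB -inner_conj. Qed.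

(** [B] is a mere function; its additivity and its bound are read off from the adjoint relation. *)
Lemma adjointB x y : B (x - y) = B x - B y.
Proof. by apply: inner_ext => z; rewrite innerBr -!AB innerBr. Qed.

Lemma adjoint_bounded M : (forall x, nrm (A x) <= M * nrm x) ->
  forall x, nrm (B x) <= M * nrm x.
Proof.
move=> hM x; have [->|B0] := eqVneq (nrm (B x)) 0.
  by rewrite (le_trans (nrm_ge0 (A x))).
have B0' : 0 < nrm (B x) by rewrite lt_def B0 nrm_ge0.
rewrite -(ler_pM2l B0') -expr2.
have -> : nrm (B x) ^+ 2 = nrm (inner (A (B x)) x).
  by rewrite AB inner_nrm nrmC ger0_norm ?sqr_ge0.
apply: le_trans (cauchy_schwarz _ _) _.
by rewrite mulrA [nrm (B x) * M]mulrC ler_wpM2r ?nrm_ge0.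
Qed.

Lemma nrm_sqrB (x y : L) :
  nrm (x - y) ^+ 2 = nrm x ^+ 2 + nrm y ^+ 2 - 2 * complex.Re (inner x y).
Proof.
have := Re_inner x (- y); rewrite innerNr nrmN raddfN /= => h.
have : complex.Re (inner x y) = - ((nrm (x - y) ^+ 2 - nrm x ^+ 2 - nrm y ^+ 2) / 2).
  by rewrite -h opprK.
by move=> ->; field.
Qed.

(* [A] attains its norm on [W]: if unit vectors [x k] of [W] satisfy
   [nrm (A (x k)) --> sigma] then [B (A (x k)) - sigma^2 x k --> 0], and compactness
   turns a cluster point of [A (x k)] into one of [x k]. *)
Lemma compact_maximizer (W : set L) (x0 : L) : compact_operator A ->
  (forall (c : R[i]) x, W x -> W (c *: x)) -> closure W `<=` W ->
  (forall x, W x -> W (B (A x))) -> W x0 -> 0 < nrm (A x0) ->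
  exists f, [/\ W f, nrm f = 1, B (A f) = (nrm (A f) ^+ 2)%:C *: f &
    forall x, W x -> nrm (A x) <= nrm (A f) * nrm x].
Proof.
move=> cA WZ Wc WH Wx0 Ax0.
have [M M1 hM] := compact_operator_bounded cA.
have hBM := adjoint_bounded hM.
have nz x : 0 < nrm (A x) -> x != 0.
  by move=> Ax; apply/eqP => xE; move: Ax; rewrite xE linear0 nrm0 ltxx.
have Wunit x : W x -> 0 < nrm (A x) -> exists2 y, W y /\ nrm y = 1 &
    nrm (A x) = nrm (A y) * nrm x.
  move=> Wx Ax; exists ((nrm x)^-1%:C *: x).
    by split; [exact: WZ | exact/unit_vector/nz].
  rewrite linearZ nrmZr ?invr_ge0 ?nrm_ge0 // mulrC mulrA mulfV ?mul1r //.
  by apply: contra (nz _ Ax) => /eqP/nrm_eq0 ->.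
pose E := [set t | exists2 x, W x /\ nrm x = 1 & t = nrm (A x)].
have hE : has_sup E.
  split; first by have [y [Wy y1] _] := Wunit _ Wx0 Ax0; exists (nrm (A y)), y.
  by exists M => _ [x [_ x1] ->]; rewrite (le_trans (hM x)) // x1 mulr1.
pose sg := sup E.
have sgE x : W x -> nrm (A x) <= sg * nrm x.
  move=> Wx; have : 0 <= nrm (A x) := nrm_ge0 _; rewrite le_eqVlt => /orP[/eqP A0|Ax].
    rewrite -A0 mulr_ge0 ?nrm_ge0 //; have [y [Wy y1] _] := Wunit _ Wx0 Ax0.
    apply: le_trans (nrm_ge0 (A y)) _; apply: ub_le_sup; first exact: hE.2.
    by exists y.
  have [y [Wy y1] ->] := Wunit _ Wx Ax; rewrite ler_wpM2r ?nrm_ge0 //.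
  by apply: ub_le_sup; [exact: hE.2 | exists y].
have sg0 : 0 < sg.
  by have := sgE _ Wx0; have := nrm_ge0 x0; move: Ax0; nra.
(* Invariance of [W] allows the bound [sg] to be used at [B (A x)]: [|B A x|^2] is the inner product
   of [A x] with [A (B (A x))], hence at most [|A x| sg |B A x|]. *)
have Hb x : W x -> nrm (B (A x)) <= sg * nrm (A x).
  move=> Wx; have [->|B0] := eqVneq (nrm (B (A x))) 0.
    by rewrite mulr_ge0 ?nrm_ge0 // ltW.
  have B0' : 0 < nrm (B (A x)) by rewrite lt_def B0 nrm_ge0.
  rewrite -(ler_pM2l B0') -expr2.
  have -> : nrm (B (A x)) ^+ 2 = nrm (inner (A x) (A (B (A x)))).
    by rewrite -adjoint_sym inner_nrm nrmC ger0_norm ?sqr_ge0.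
  apply: le_trans (cauchy_schwarz _ _) _; have := sgE _ (WH _ Wx).
  by have := nrm_ge0 (A x); nra.
(* Expanding the square gives [sg^4 - 2 sg^2 |A x|^2 + |B A x|^2], and the last term is at most
   [sg^2 |A x|^2]. *)
have defect x : W x -> nrm x = 1 ->
    nrm ((sg ^+ 2)%:C *: x - B (A x)) ^+ 2 <= sg ^+ 2 * (sg ^+ 2 - nrm (A x) ^+ 2).
  move=> Wx x1; rewrite nrm_sqrB nrmZr ?sqr_ge0 // x1 mulr1 innerZl -AB inner_nrm.
  rewrite conjcR -rmorphM /=.
  have := Hb _ Wx; have := nrm_ge0 (A x); have := nrm_ge0 (B (A x)) => h1 h2 h3.
  have : nrm (B (A x)) ^+ 2 <= (sg * nrm (A x)) ^+ 2 by rewrite ler_pXn2r ?nnegrE ?mulr_ge0 // ltW.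
  by rewrite exprMn; lra.
have /choice[x xW] : forall k : nat, exists x, [/\ W x, nrm x = 1 &
    sg - k.+1%:R^-1 < nrm (A x)].
  move=> k; have k0 : 0 < k.+1%:R^-1 :> R by rewrite invr_gt0.
  by have [_ [x [Wx x1] ->] xk] := sup_adherent k0 hE; exists x.
have [|y ycl] := compact_operator_cluster cA (x := x).
  by move=> k; case: (xW k) => _ ->.
have sg2 : 0 < sg ^+ 2 by rewrite exprn_gt0.
(* When [A (x k)] is near [y], [B (A (x k))] is near [B y], and by the defect estimate near
   [sg^2 x k]; so [x k] is near this [f]. *)
pose f := (sg ^+ 2)^-1%:C *: B y.
have approx e : 0 < e -> exists z, [/\ W z, nrm z = 1, nrm (z - f) <= e &
    sg - e <= nrm (A z)].
  move=> e0; pose t := sg ^+ 2 * e / 2.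
  have t0 : 0 < t by rewrite !mulr_gt0 // invr_gt0.
  (* Two errors of size [t] add up to [sg^2 e]. The bound [t / M] controls [B (A (x k)) - B y]; the
     last one controls the defect, whose square is at most [sg^2 * 2 sg d]. *)
  pose d := Num.min e (Num.min (t / M) (t ^+ 2 / (sg ^+ 2 * (2 * sg)))).
  have M0 : 0 < M by exact: lt_le_trans M1.
  have s30 : 0 < sg ^+ 2 * (2 * sg) by rewrite !mulr_gt0.
  have d0 : 0 < d by rewrite !lt_min e0 (divr_gt0 t0 M0) (divr_gt0 _ s30) // exprn_gt0.
  have de : d <= e by rewrite ge_min lexx.
  have dM : d * M <= t by rewrite -ler_pdivlMr // !ge_min lexx !orbT.
  have ds : d * (sg ^+ 2 * (2 * sg)) <= t ^+ 2.
    by rewrite -ler_pdivlMr // !ge_min lexx !orbT.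
  have [N Nd] := inv_nat_below d0; have [k Nk kd] := ycl _ d0 N.
  have [Wk k1 kA] := xW k; have kd' := Nd _ Nk.
  have Ak : sg - d <= nrm (A (x k)).
    by apply/ltW/(le_lt_trans _ kA); rewrite lerD2l lerN2 ltW.
  exists (x k); split=> //; last by lra.
  have Ak2 : sg ^+ 2 - 2 * sg * d <= nrm (A (x k)) ^+ 2.
    have a0 := nrm_ge0 (A (x k)); have [sd|/ltW sd] := lerP d sg.
      have : (sg - d) ^+ 2 <= nrm (A (x k)) ^+ 2 by rewrite ler_pXn2r ?nnegrE ?subr_ge0.
      by have := sqr_ge0 d; lra.
    have : sg * sg <= sg * d by rewrite ler_wpM2l // ltW.
    by have := sqr_ge0 (nrm (A (x k))); have := sqr_ge0 sg; lra.
  have h1 : nrm ((sg ^+ 2)%:C *: x k - B (A (x k))) <= t.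
    rewrite -(@ler_pXn2r _ 2) ?nnegrE ?nrm_ge0 ?(ltW t0) //.
    apply: le_trans (defect _ Wk k1) _; apply: le_trans ds.
    by rewrite [leRHS]mulrCA ler_wpM2l ?(ltW sg2) //; lra.
  have h2 : nrm (B (A (x k)) - B y) <= t.
    rewrite -adjointB; apply: le_trans (hBM _) _; rewrite mulrC.
    by apply: le_trans dM; rewrite ler_wpM2r ?(ltW M0) // ltW.
  have := nrm_triangle (B (A (x k))) ((sg ^+ 2)%:C *: x k) (B y).
  have -> : (sg ^+ 2)%:C *: x k - B y = (sg ^+ 2)%:C *: (x k - f).
    by rewrite scalerBr scalerA -rmorphM /= mulfV ?lt0r_neq0 // scale1r.
  rewrite nrmZr ?sqr_ge0 // => h; rewrite -(ler_pM2l sg2).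
  apply: le_trans h _; apply: le_trans (lerD h1 h2) _.
  by rewrite /t -splitr.
have Wf : W f.
  apply: Wc; apply/closure_nrm => e e0.
  have e2 : 0 < e / 2 by rewrite divr_gt0.
  have [z [Wz _ zf _]] := approx _ e2; exists z => //; rewrite nrmB.
  by apply: le_lt_trans zf _; lra.
have f1 : nrm f = 1.
  apply/eqP; rewrite eq_le; apply/andP; split; apply/ler_addgt0Pr => e e0;
    have [z [_ <- zf _]] := approx _ e0.
    by apply: le_trans (nrm_leD f z) _; rewrite nrmB lerD2l.
  by apply: le_trans (nrm_leD z f) _; rewrite lerD2l.
have Af : nrm (A f) = sg.
  apply/eqP; rewrite eq_le; apply/andP; split.
    by have := sgE _ Wf; rewrite f1 mulr1.
  apply: (@le_of_le_eps _ _ _ (1 + M)) => e /andP[e0 _].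
  have [z [_ _ zf Az]] := approx _ e0.
  have := nrm_leD (A z) (A f); rewrite -linearB.
  have := hM (z - f); have : M * nrm (z - f) <= M * e by rewrite ler_wpM2l //; lra.
  by rewrite /=; lra.
exists f; split=> //; last by rewrite Af.
(* At a vector that attains [sg] the defect is zero, which is the eigenvector equation. *)
rewrite Af; apply/eqP; rewrite eq_sym -subr_eq0; apply/eqP/nrm_eq0/eqP.
rewrite -sqrf_eq0 eq_le sqr_ge0 andbT.
by have := defect _ Wf f1; rewrite Af subrr mulr0.
Qed.

End adjoint_theory.

(** * Finite systems of singular vectors and Schatten sums *)

Section schatten_theory.
Variables (R : realType) (L : hilbertType R) (A : {linear L -> L}) (B : L -> L).
Hypothesis AB : is_adjoint A B.

(** [B] stands for [A^*], so the numbers [nrm (A (u i))] are singular values. Their positivity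
    excludes zero vectors, and the system is truly orthonormal. *)
Definition eigensystem n (u : nat -> L) := orthosystem n u /\
  forall i, (i < n)%N ->
    0 < nrm (A (u i)) /\ B (A (u i)) = (nrm (A (u i)) ^+ 2)%:C *: u i.

Section eigensystem_facts.
Variables (n : nat) (u : nat -> L).
Hypothesis hu : eigensystem n u.

Lemma eigensystem_unit i : (i < n)%N -> inner (u i) (u i) = 1.
Proof.
move=> ni; have u0 : u i != 0.
  by apply/eqP => u0; have [] := hu.2 _ ni; rewrite u0 linear0 nrm0 ltxx.
have /eqP : (inner (u i) (u i) - 1) *: u i = 0.
  by rewrite scalerBl (hu.1.2 _ ni) scale1r subrr.
by rewrite scaler_eq0 (negbTE u0) orbF subr_eq0 => /eqP.
Qed.

Lemma eigensystem_inner i x : (i < n)%N ->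
  inner (A (u i)) (A x) = (nrm (A (u i)) ^+ 2)%:C * inner (u i) x.
Proof.
by move=> ni; rewrite -(adjoint_sym AB) (hu.2 _ ni).2 innerZl conjcR.
Qed.

Lemma eigensystem_orth i j : (i < n)%N -> (j < n)%N -> i <> j ->
  inner (A (u i)) (A (u j)) = 0.
Proof. by move=> ni nj ij; rewrite eigensystem_inner // hu.1.1 ?mulr0. Qed.

(** Since [A^* A] acts on each [u i] as a scalar, [A] maps the [u i] to orthogonal vectors, all
    orthogonal to the image of the complement of their span. *)
Lemma eigensystem_pythagoras x : nrm (A x) ^+ 2 =
  \sum_(i < n) nrm (A (u i)) ^+ 2 * nrm (inner (u i) x) ^+ 2 +
  nrm (A (x - proj n u x)) ^+ 2.
Proof.
have AP : A (proj n u x) = \sum_(i < n) inner (u i) x *: A (u i).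
  by rewrite linear_sum; apply: eq_bigr => i _; rewrite linearZ.
rewrite -{1}[x](subrKC (proj n u x)) [X in nrm X ^+ 2 = _]linearD nrm_sqrD.
  rewrite AP nrm_sqr_sum; last first.
    move=> i j ij; rewrite innerZl innerZr eigensystem_orth ?mulr0 //.
    by move=> /val_inj ij'; rewrite ij' eqxx in ij.
  by congr (_ + _); apply: eq_bigr => i _; rewrite nrmZ exprMn mulrC.
rewrite AP inner_suml big1 // => i _.
by rewrite innerZl eigensystem_inner // (proj_compl hu.1) // !mulr0.
Qed.

End eigensystem_facts.

(** The complement of an eigensystem is closed and invariant under [A^* A], so [A] attains its norm
    there. The vector [x] shows that this norm exceeds [e]. *)
Lemma eigensystem_step n u (e : R) x : compact_operator A -> 0 < e ->
  eigensystem n u -> (forall i, (i < n)%N -> inner (u i) x = 0) ->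
  e * nrm x < nrm (A x) ->
  exists f, eigensystem n.+1 (extend n u f) /\ e <= nrm (A f).
Proof.
move=> cA e0 hu ux ex.
pose W := [set x | forall i, (i < n)%N -> inner (u i) x = 0].
have Ax0 : 0 < nrm (A x).
  by apply: le_lt_trans ex; rewrite mulr_ge0 ?nrm_ge0 // ltW.
have [|||f [Wf f1 Hf fmax]] := @compact_maximizer _ _ _ _ AB W x cA _ _ _ ux Ax0.
- by move=> c y Wy i ni; rewrite innerZr Wy ?mulr0.
- move=> y cy i ni; apply/inner_sym0; apply: closure_inner0 cy => z Wz.
  by apply/inner_sym0; exact: Wz.
- by move=> y Wy i ni; rewrite -AB (eigensystem_inner hu) // Wy ?mulr0.
have x0 : 0 < nrm x.
  rewrite lt_def nrm_ge0 andbT; apply/eqP => /nrm_eq0 xE.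
  by move: Ax0; rewrite xE linear0 nrm0 ltxx.
have ef : e < nrm (A f).
  by rewrite -(ltr_pM2r x0); apply: lt_le_trans ex _; exact: fmax.
exists f; split; last exact: ltW.
split; first by apply: orthosystem_extend; rewrite ?inner_nrm ?f1 ?expr1n ?scale1r //; exact: hu.1.
move=> i; rewrite ltnS leq_eqVlt => /orP[/eqP ->|ni].
  by rewrite extend_last; split=> //; exact: lt_trans ef.
by rewrite extend_lt //; exact: hu.2.
Qed.

Lemma dimension_ge n (v : 'I_n -> L) (W : set L) : (forall i, W (v i)) ->
  (forall i j, inner (v i) (v j) = (i == j)%:R) -> (n%:R%:E <= dimension W)%E.
Proof.
move=> Wv vv; apply: ereal_sup_ubound; exists n => //; exists v; split=> // c cv i.
have := congr1 (inner (v i)) cv; rewrite inner0r inner_sumr (bigD1 i) //= big1 ?addr0.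
  by rewrite innerZr vv eqxx mulr1.
by move=> j ji; rewrite innerZr vv eq_sym (negbTE ji) mulr0.
Qed.

Lemma dimension_ge0 (W : set L) : (0 <= dimension W)%E.
Proof.
by apply: (@dimension_ge 0 (fun=> 0)) => -[].
Qed.

Lemma schatten_sum_ge0 (r : R) : (0 <= schatten_sum r A)%E.
Proof.
by apply: esum_ge0 => s _; rewrite mule_ge0 ?dimension_ge0 // lee_fin powR_ge0.
Qed.

Lemma eigensystem_schatten_sum n u (r : R) : eigensystem n u ->
  ((\sum_(i < n) nrm (A (u i)) `^ r)%:E <= schatten_sum r A)%E.
Proof.
move=> hu; pose m (i : 'I_n) := nrm (A (u i)).
(* The Schatten sum runs over distinct singular values, so the indices are grouped by value. Those
   with value [t] give orthonormal vectors in [singular_space A t], whose dimension is at least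
   their number. *)
pose vs := undup [seq m i | i <- enum 'I_n].
have mvs i : m i \in vs by rewrite mem_undup map_f // mem_enum.
have -> : \sum_(i < n) nrm (A (u i)) `^ r = \sum_(t <- vs) #|[pred i | m i == t]|%:R * t `^ r.
  transitivity (\sum_(i < n) \sum_(t <- vs | m i == t) t `^ r).
    apply: eq_bigr => i _; rewrite big_mkcond (bigD1_seq (m i)) ?undup_uniq ?mvs //=.
    by rewrite eqxx big1 ?addr0 // => t; rewrite eq_sym => /negPf ->.
  rewrite (exchange_big_dep xpredT) //=; apply: eq_bigr => t _.
  by rewrite mulr_natl -sumr_const; apply: eq_bigl => i; rewrite inE.
apply: esum_ge; exists [set` vs].
  split; first exact: finite_seq.
  by move=> t /=; rewrite mem_undup => /mapP[i _ ->]; case: (hu.2 i (ltn_ord i)).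
rewrite -fsbig_seq ?undup_uniq // -sumEFin !big_seq; apply: lee_sum => t tvs.
rewrite EFinM lee_wpmul2r ?lee_fin ?powR_ge0 //.
apply: (@dimension_ge _ (fun k => u (@enum_val 'I_n [pred i | m i == t] k))) => [k|k l].
  have := enum_valP k; rewrite inE; move: (enum_val k) => i /eqP mi.
  by exists B => //; have [_ ->] := hu.2 _ (ltn_ord i); rewrite -mi.
have [->|kl] := eqVneq k l; first by rewrite (eigensystem_unit hu).
apply: hu.1.1 => // /val_inj /enum_val_inj kl'; by rewrite kl' eqxx in kl.
Qed.

Section schatten_class_facts.
Variable r : R.
Hypotheses (hr : 1 <= r <= 2) (hA : schatten_class r A).

Lemma eigensystem_schatten n u : eigensystem n u ->
  \sum_(i < n) nrm (A (u i)) `^ r <= fine (schatten_sum r A).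
Proof.
move=> /(@eigensystem_schatten_sum _ _ r) h.
rewrite -lee_fin fineK // ge0_fin_numE ?schatten_sum_ge0 //; exact: hA.2.
Qed.

Lemma eigensystem_exhaust (e : R) : 0 < e ->
  exists n u, eigensystem n u /\
    forall x, (forall i, (i < n)%N -> inner (u i) x = 0) -> nrm (A x) <= e * nrm x.
Proof.
move=> e0; apply: contrapT => hno.
have big n : exists u, eigensystem n u /\ forall i, (i < n)%N -> e <= nrm (A (u i)).
  elim: n => [|n [u [hu eu]]]; first by exists (fun=> 0).
  have [x [ux xe]] : exists x, (forall i, (i < n)%N -> inner (u i) x = 0) /\
      e * nrm x < nrm (A x).
    apply: contrapT => nox; apply: hno; exists n, u; split=> // x ux.
    by rewrite leNgt; apply/negP => ex; apply: nox; exists x.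
  have [f [hf ef]] := eigensystem_step hA.1 e0 hu ux xe.
  exists (extend n u f); split=> // i; rewrite ltnS leq_eqVlt => /orP[/eqP ->|ni].
    by rewrite extend_last.
  by rewrite extend_lt //; exact: eu.
have er : 0 < e `^ r by rewrite powR_gt0.
(* With this many eigenvectors of singular value at least [e], their contribution [n e^r] exceeds
   the whole Schatten sum. *)
have [n hn] := nat_above (fine (schatten_sum r A) / e `^ r).
have [u [hu eu]] := big n; have := eigensystem_schatten hu.
have r0 : 0 <= r by case/andP: hr; lra.
suff : n%:R * e `^ r <= \sum_(i < n) nrm (A (u i)) `^ r.
  by move: hn; rewrite ltr_pdivrMr //; lra.
rewrite mulr_natl -[X in _ *+ X](card_ord n) -sumr_const; apply: ler_sum => i _.
by apply: ge0_ler_powR => //; rewrite ?nnegrE ?nrm_ge0 ?eu //; exact: ltW.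
Qed.

(** Expanding [|A v_i|^2] along an eigensystem and using Bessel's inequality for [v] bounds the sum
    by that of the squared singular values [mu_j], up to an error [e] per vector. As [mu_j <= M] and
    [r <= 2], [mu_j^2 <= M^(2-r) mu_j^r], whence the constant. *)
Lemma schatten_hilbert_schmidt : exists C, forall n u, orthosystem n u ->
  \sum_(i < n) nrm (A (u i)) ^+ 2 <= C.
Proof.
have [M M1 hM] := compact_operator_bounded hA.1.
have M0 : 0 < M by exact: lt_le_trans M1.
case/andP: hr => r1 r2.
exists (M `^ (2 - r) * fine (schatten_sum r A)) => m v hv.
apply: (@le_of_le_eps _ _ _ m%:R) => e /andP[e0 e1].
have [n [u [hu hW]]] := eigensystem_exhaust e0.
have hvi i : (i < m)%N -> nrm (A (v i)) ^+ 2 <=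
    \sum_(j < n) nrm (A (u j)) ^+ 2 * nrm (inner (v i) (u j)) ^+ 2 + e.
  move=> im; rewrite (eigensystem_pythagoras hu) lerD //.
    by apply: ler_sum => j _; rewrite inner_conj nrm_conj.
  have w0 := nrm_ge0 (v i - proj n u (v i)).
  have w1 : nrm (v i - proj n u (v i)) <= 1.
    by apply: le_trans (nrm_projC hu.1 _) _; exact: orthosystem_le1 im.
  have he : nrm (A (v i - proj n u (v i))) <= e.
    apply: le_trans (hW _ (fun j nj => proj_compl hu.1 (v i) nj)) _.
    by rewrite ler_piMr // ltW.
  have := nrm_ge0 (A (v i - proj n u (v i))); nra.
apply: le_trans (ler_sum _ (fun i _ => hvi _ (ltn_ord i))) _.
rewrite big_split /= sumr_const card_ord -[e *+ m]mulr_natr lerD2r.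
rewrite exchange_big /=.
apply: (@le_trans _ _ (\sum_(j < n) M `^ (2 - r) * nrm (A (u j)) `^ r)); last first.
  by rewrite -mulr_sumr ler_wpM2l ?powR_ge0 ?eigensystem_schatten.
apply: ler_sum => j _; rewrite -mulr_sumr.
have [Aj0 _] := hu.2 _ (ltn_ord j).
have uj := orthosystem_le1 hu.1 (ltn_ord j).
have AjM : nrm (A (u j)) <= M 
  by apply: le_trans (hM _) _; rewrite ler_piMr // ltW.
apply: (@le_trans _ _ (nrm (A (u j)) ^+ 2)).
  rewrite ler_piMr ?sqr_ge0 //; apply: le_trans (bessel hv _) _.
  by rewrite expr_le1 ?nrm_ge0.
have -> : nrm (A (u j)) ^+ 2 = nrm (A (u j)) `^ (2 - r) * nrm (A (u j)) `^ r.
  by rewrite -powRD ?(gt_eqF Aj0) ?implybT // subrK powR_mulrn ?nrm_ge0.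
rewrite ler_wpM2r ?powR_ge0 //; apply: ge0_ler_powR => //.
- by rewrite subr_ge0.
- by rewrite nnegrE nrm_ge0.
- by rewrite nnegrE ltW.
Qed.

End schatten_class_facts.
End schatten_theory.

(** * Hölder's inequality and tails of bounded sums *)

Section real_inequalities.
Variable R : realType.

(** Young's inequality, term by term, after dividing by [T^(1/p)] and [N^(1/q)]. If [T] or [N] is
    zero, one of the families vanishes. *)
Lemma hoelder_sum n (m y : 'I_n -> R) (p q T N : R) :
  (forall k, 0 <= m k) -> (forall k, 0 <= y k) ->
  0 < p -> 0 < q -> p^-1 + q^-1 = 1 -> 0 <= T -> 0 <= N ->
  \sum_k m k `^ p <= T -> \sum_k y k `^ q <= N ->
  \sum_k m k * y k <= T `^ p^-1 * N `^ q^-1.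
Proof.
move=> m0 y0 p0 q0 pq T0 N0 mT yN.
have vanish (x : 'I_n -> R) t : (forall k, 0 <= x k) -> 0 < t ->
    \sum_k x k `^ t <= 0 -> forall k, x k = 0.
  move=> x0 t0 xt k; have : x k `^ t == 0.
    rewrite eq_le powR_ge0 andbT; apply: le_trans xt.
    by rewrite (bigD1 k) //= lerDl sumr_ge0 // => j _; exact: powR_ge0.
  by rewrite powR_eq0 => /andP[/eqP].
move: T0 mT; rewrite le_eqVlt => /orP[/eqP <-|T0] mT.
  by rewrite big1 ?mulr_ge0 ?powR_ge0 // => k _; rewrite (vanish m p) ?mul0r.
move: N0 yN; rewrite le_eqVlt => /orP[/eqP <-|N0] yN.
  by rewrite big1 ?mulr_ge0 ?powR_ge0 // => k _; rewrite (vanish y q) ?mulr0.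
have scale (S t x : R) : 0 < S -> 0 < t -> 0 <= x ->
    (x / S `^ t^-1) `^ t = x `^ t / S.
  move=> S0 t0 x0; rewrite powRM ?invr_ge0 ?powR_ge0 //; congr (_ * _).
  rewrite -powR_inv1 ?powR_ge0 // -!powRrM mulN1r mulrN mulVf ?gt_eqF //.
  by rewrite powR_inv1 // ltW.
have Tp : 0 < T `^ p^-1 by rewrite powR_gt0.
have Nq : 0 < N `^ q^-1 by rewrite powR_gt0.
have step k : m k * y k <= T `^ p^-1 * N `^ q^-1 *
    (m k `^ p / T / p + y k `^ q / N / q).
  rewrite -(scale T p) // -(scale N q) //.
  have -> : m k * y k = T `^ p^-1 * N `^ q^-1 * ((m k / T `^ p^-1) * (y k / N `^ q^-1)).
    by field; rewrite !gt_eqF.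
  rewrite ler_wpM2l ?mulr_ge0 ?powR_ge0 //.
  by apply: conjugate_powR; rewrite ?divr_ge0 ?powR_ge0.
apply: le_trans (ler_sum _ (fun k _ => step k)) _.
rewrite -mulr_sumr ler_piMr ?mulr_ge0 ?powR_ge0 //.
rewrite big_split /= -!mulr_suml -pq lerD //.
  by rewrite ler_piMl ?invr_ge0 ?(ltW p0) // ler_pdivrMr // mul1r.
by rewrite ler_piMl ?invr_ge0 ?(ltW q0) // ler_pdivrMr // mul1r.
Qed.

(* Hölder with exponents [r] and [r' = r / (r - 1) >= 2], where
   [\sum x^r' <= X^(r'-2) \sum x^2 <= N X^r']. *)
Lemma weighted_sum_bound n (m x : 'I_n -> R) (r T N X : R) : 1 <= r <= 2 ->
  (forall k, 0 <= m k) -> (forall k, 0 <= x k <= X) -> 0 <= T -> 0 <= N -> 0 <= X ->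
  \sum_k m k `^ r <= T -> \sum_k x k ^+ 2 <= N * X ^+ 2 ->
  \sum_k m k * x k <= T `^ r^-1 * N `^ ((r - 1) / r) * X.
Proof.
move=> /andP[r1 r2] m0 xX T0 N0 X0 mT xN.
have x0 k : 0 <= x k by case/andP: (xX k).
move: mT; have [->|r1'] := eqVneq r 1 => mT.
  rewrite subrr mul0r powRr0 mulr1 invr1 powRr1 //.
  apply: (@le_trans _ _ ((\sum_k m k `^ 1) * X)); last by rewrite ler_wpM2r.
  rewrite mulr_suml; apply: ler_sum => k _; rewrite powRr1 // ler_wpM2l //.
  by case/andP: (xX k).
have r1'' : 0 < r - 1 by rewrite subr_gt0 lt_def r1'.
have r0 : 0 < r by lra.
move: X0; rewrite le_eqVlt => /orP[/eqP X0|X0].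
  rewrite -X0 mulr0 big1 // => k _; rewrite (_ : x k = 0) ?mulr0 //.
  by apply/eqP; rewrite eq_le x0 andbT; case/andP: (xX k); rewrite -X0.
have -> : \sum_k m k * x k = (\sum_k m k * (x k / X)) * X.
  by rewrite mulr_suml; apply: eq_bigr => k _; field; rewrite gt_eqF.
rewrite ler_wpM2r ?(ltW X0) // -(invf_div r (r - 1)).
have y0 k : 0 <= x k / X by rewrite divr_ge0 // ltW.
apply: hoelder_sum => //; first by rewrite divr_gt0.
  by rewrite invf_div; field; rewrite gt_eqF.
apply: (@le_trans _ _ (\sum_k (x k / X) ^+ 2)); last first.
  under eq_bigr do rewrite expr_div_n.
  by rewrite -mulr_suml ler_pdivrMr // exprn_gt0.
apply: ler_sum => k _; move: (y0 k); rewrite le_eqVlt => /orP[/eqP <-|yk].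
  by rewrite powR0 ?expr0n // gt_eqF // divr_gt0.
rewrite -powR_mulrn ?(ltW yk) //; apply: ger_powR.
  by rewrite yk ler_pdivrMr // mul1r; case/andP: (xX k).
by rewrite ler_pdivlMr //; lra.
Qed.

Lemma bounded_tail (w : nat -> R) (K : R) : (forall j, 0 <= w j) ->
  (forall n, \sum_(j < n) w j <= K) -> forall d, 0 < d ->
  exists M, forall m n, (M <= m)%N -> \sum_(m <= j < n) w j <= d.
Proof.
move=> w0 wK d d0; pose E := [set t | exists n : nat, t = \sum_(0 <= j < n) w j].
have hE : has_sup E.
  split; first by exists (\sum_(0 <= j < 0) w j), 0%N.
  by exists K => _ [n ->]; rewrite big_mkord.
have [_ [M ->] hM] := sup_adherent d0 hE.
exists M => m n Mm; have [nm|/ltnW mn] := leqP n m; first by rewrite big_geq // ltW.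
have : \sum_(0 <= j < n) w j <= sup E by apply: ub_le_sup; [exact: hE.2 | exists n].
rewrite (big_cat_nat (n := M)) //=; last exact: leq_trans mn.
rewrite [X in _ + X <= _ -> _](big_cat_nat (n := m)) //=.
have : 0 <= \sum_(M <= j < m) w j by apply: sumr_ge0.
by move: hM; lra.
Qed.

End real_inequalities.

(** * Expansion in complete systems, and the adjoint of a skew operator *)

Section complete_systems.
Variables (R : realType) (V : hilbertType R).
Implicit Types (u : nat -> V) (x : V).

Lemma proj_sub n u x y : proj n u (x - y) = proj n u x - proj n u y.
Proof. by rewrite /proj -sumrB; apply: eq_bigr => i _; rewrite innerBr scalerBl. Qed.

Lemma proj_member n u i : orthosystem n u -> (i < n)%N -> proj n u (u i) = u i.
Proof.
move=> hu ni; rewrite /proj (bigD1 (Ordinal ni)) //= hu.2 // big1 ?addr0 // => j /eqP ji.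
by rewrite hu.1 ?scale0r // => ij; apply: ji; apply/val_inj.
Qed.

(** A nearby [y] in the span is fixed by all late projections, and [1 - proj] does not increase the
    norm of [x - y]. *)
Lemma proj_dense u : (forall n, orthosystem n u) -> dense (lspan (range u)) ->
  forall x (e : R), 0 < e -> exists N, forall n, (N <= n)%N -> nrm (x - proj n u x) <= e.
Proof.
move=> hu du x e e0; have [y uy xy] := dense_nrm x du e0.
have [N yN] : exists N, forall n, (N <= n)%N -> proj n u y = y.
  move: y uy {xy}; apply: lspan_ind => [|y z [N yN] [M zM]|c y [N yN]|y [i _ <-]].
  - by exists 0%N => n _; rewrite /proj big1 // => i _; rewrite inner0r scale0r.
  - exists (maxn N M) => n; rewrite geq_max => /andP[nN nM].
    rewrite -{2}(yN _ nN) -{2}(zM _ nM) /proj -big_split /=.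
    by apply: eq_bigr => i _; rewrite innerDr scalerDl.
  - exists N => n nN; rewrite -{2}(yN _ nN) /proj scaler_sumr.
    by apply: eq_bigr => i _; rewrite innerZr scalerA.
  - by exists i.+1 => n ni; exact: proj_member.
exists N => n nN.
have -> : x - proj n u x = (x - y) - proj n u (x - y).
  by rewrite proj_sub (yN _ nN) opprB addrA subrK.
by apply: le_trans (nrm_projC (hu n) _) _; exact: ltW.
Qed.

End complete_systems.

Section conjugate_adjoint.
Variables (R : realType) (L : hilbertType R) (J : L -> L) (A : L -> L).

(** The hypothesis says that [J A J] has adjoint [- A]; conjugating both sides by [J] gives the
    adjoint of [A] in closed form. *)
Lemma skew_adjoint : conjugation J -> is_transpose J A (fun f => - A f) ->
  is_adjoint A (fun g => J (- A (J g))).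
Proof.
move=> hJ hA f g; have := hA (J f) (J g).
rewrite /conj_op (conjugationK hJ) (inner_conjugation hJ) => h.
rewrite inner_conj h -{1}[- A (J g)](conjugationK hJ) (inner_conjugation hJ).
by rewrite -inner_conj.
Qed.

End conjugate_adjoint.

(** * Convergence and norm bound of [Delta] *)

Section delta_bound.
Variables (R : realType) (L F : hilbertType R) (J : L -> L).
Variables (a adag : L -> {linear F -> F}) (Omega : F).
Hypotheses (hJ : conjugation J) (hF : fock_representation J a adag Omega).
Variables (D : set nat) (e : nat -> L) (he : complete_orthonormal D e).
Variables (r : R) (hr : 1 <= r <= 2).
Variables (A : {linear L -> L}) (B : L -> L).
Hypotheses (hA : schatten_class r A) (AB : is_adjoint A B).

Local Notation pspace := (particle_space adag Omega).
(** Continued by zero outside [D], the basis is an orthosystem indexed by all natural numbers, and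
    the added terms of [Delta] vanish. *)
Local Notation u := (fun j => if j \in D then e j else 0).
Local Notation T := (fine (schatten_sum r A)).
Local Notation term phi j := (a (A (u j)) (a (J (u j)) phi)).

Lemma orthosystem_basis n : orthosystem n u.
Proof.
split=> [i j _ _ ij|i _].
  case: ifP => [|_]; last by rewrite inner0l.
  case: ifP => [|_]; last by rewrite inner0r.
  by rewrite !inE => Dj Di; rewrite he.1 //; case: eqP.
case: ifP; last by rewrite scaler0.
by rewrite inE => Di; rewrite he.1 // eqxx scale1r.
Qed.

Lemma dense_basis : dense (lspan (range u)).
Proof.
move=> O O0 oO; have [x [Ox ex]] := he.2 O O0 oO; exists x; split=> //.
move: x ex {Ox}; apply: lspan_ind.
- exact: lspan0.
- exact: lspanD.
- exact: lspanZ.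
- by move=> _ [i Di <-]; apply: lspan_sub; exists i => //=; rewrite mem_set.
Qed.

Lemma Delta_partial_sum n phi :
  \sum_(j < n | (j : nat) \in D) a (A (e j)) (a (J (e j)) phi) = \sum_(j < n) term phi j.
Proof.
rewrite big_mkcond; apply: eq_bigr => j _; case: ifP => // _.
by rewrite linear0 (fock_a0 hF).
Qed.

Section fixed_particle_number.
Variables (p : nat) (phi : F).
Hypothesis pphi : pspace p phi.

Lemma nrm_a_basis i : nrm (a (J (u i)) phi) <= nrm phi.
Proof.
apply: le_trans (nrm_fock_a hJ hF _ _) _; rewrite (nrm_conjugation hJ).
by rewrite ler_piMl ?nrm_ge0 //; exact: orthosystem_le1 (orthosystem_basis i.+1) _.
Qed.

(** A summable majorant of the terms of [Delta]: a product is at most the sum of the squares, and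
    both squares are summable, by the Hilbert-Schmidt bound and by the number operator. *)
Let w j := nrm (A (u j)) ^+ 2 + nrm (a (J (u j)) phi) ^+ 2.

Let w_ge0 j : 0 <= w j.
Proof. by rewrite addr_ge0 ?sqr_ge0. Qed.

(** Stated for any smaller [x] in order to cover both [A (u j)] and its part left over by a
    projection. *)
Let mul_le_w x j : 0 <= x <= nrm (A (u j)) -> x * nrm (a (J (u j)) phi) <= w j.
Proof.
rewrite /w; have := nrm_ge0 (a (J (u j)) phi).
move: (nrm (A _)) (nrm (a _ _)) => b y y0 /andP[x0 xb].
have : x * y <= b * y by rewrite ler_wpM2r.
by have := sqr_ge0 (b - y); have := sqr_ge0 (b + y); lra.
Qed.

Let nrm_term j : nrm (term phi j) <= w j.
Proof.
apply: le_trans (nrm_fock_a hJ hF _ _) _; apply: mul_le_w.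
by rewrite nrm_ge0 lexx.
Qed.

Let w_tail (d : R) : 0 < d ->
  exists M, forall m n, (M <= m)%N -> \sum_(m <= j < n) w j <= d.
Proof.
have [C hC] := schatten_hilbert_schmidt AB hr hA.
apply: (@bounded_tail _ w (C + p%:R * nrm phi ^+ 2)) => // n.
rewrite big_split lerD //=; first exact: (hC _ _ (orthosystem_basis n)).
exact: (number_pspace hJ hF (orthosystem_basis n) pphi).
Qed.

Lemma Delta_cvg : exists l : F, (fun n => \sum_(j < n) term phi j) @ \oo --> l.
Proof.
apply: cauchy_nrm => d d0; have [M hM] := w_tail (divr_gt0 d0 (ltr0Sn R 1)).
exists M => m n Mm mn.
rewrite -!(big_mkord xpredT (fun j => term phi j)) (big_cat_nat (n := m) (p := n)) //=.
rewrite addrAC subrr add0r; apply: le_lt_trans (nrm_sum _ _ _) _.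
apply: le_lt_trans (ler_sum _ (fun j _ => nrm_term j)) _.
by apply: le_lt_trans (hM m n Mm) _; lra.
Qed.

(* [A] is replaced by [A] composed with the projection onto the eigensystem [f],
   and the partial sums of the basis expansion are moved to the other factor. *)
Lemma Delta_finite_rank n m f :
  \sum_(j < n) a (A (proj m f (u j))) (a (J (u j)) phi) =
  \sum_(k < m) a (A (f k)) (a (J (proj n u (f k))) phi).
Proof.
under eq_bigr do rewrite linear_sum (fock_a_sum hF).
rewrite exchange_big /=; apply: eq_bigr => k _.
have -> : J (proj n u (f k)) = \sum_(j < n) inner (f k) (u j) *: J (u j).
  rewrite /proj; elim/big_rec2: _ => [|j y z _ <-].
    exact: (conjugation0 hJ).
  by rewrite (conjugationD hJ) (conjugationZ hJ) -inner_conj.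
rewrite (fock_a_sum hF) linear_sum; apply: eq_bigr => j _.
by rewrite !linearZ /= !(fock_aZ hF) linearZ.
Qed.

(** Three errors of size [d / 3]: replacing [proj n u (f k)] by [f k], the first [M] terms of the
    remainder, and its terms beyond [M]. The choices depend on each other in the order [M], [eps],
    eigensystem [f], [eta]. *)
Lemma Delta_partial_bound (d : R) : 0 < d -> exists N, forall n, (N <= n)%N ->
  nrm (\sum_(j < n) term phi j) <=
    T `^ r^-1 * p%:R `^ ((r - 1) / r) * nrm phi + d.
Proof.
move=> d0; have d3 : 0 < d / 3 by rewrite divr_gt0.
have X0 := nrm_ge0 phi.
have [M hM] := w_tail d3.
have MX : 0 < M%:R * nrm phi + 1 by rewrite ltr_wpDl // mulr_ge0.
pose eps := d / 3 / (M%:R * nrm phi + 1).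
have eps0 : 0 < eps by rewrite divr_gt0.
have [m [f [hf hW]]] := eigensystem_exhaust AB hr hA eps0.
pose S := \sum_(k < m) nrm (A (f k)) * nrm phi.
have S0 : 0 < S + 1 by rewrite ltr_wpDl // sumr_ge0 // => k _; rewrite mulr_ge0 ?nrm_ge0.
pose eta := d / 3 / (S + 1).
have eta0 : 0 < eta by rewrite divr_gt0.
have /choice[Nf hNf] := fun k : 'I_m =>
  proj_dense orthosystem_basis dense_basis (f k) eta0.
exists (maxn M (\max_(k < m) Nf k)) => n; rewrite geq_max => /andP[Mn Nn].
pose v j := u j - proj m f (u j).
have -> : \sum_(j < n) term phi j =
    \sum_(k < m) a (A (f k)) (a (J (proj n u (f k))) phi) +
    \sum_(j < n) a (A (v j)) (a (J (u j)) phi).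
  rewrite -Delta_finite_rank -big_split /=; apply: eq_bigr => j _.
  by rewrite -(fock_aD hF) -linearD subrKC.
have head : nrm (\sum_(k < m) a (A (f k)) (a (J (proj n u (f k))) phi)) <=
    T `^ r^-1 * p%:R `^ ((r - 1) / r) * nrm phi + d / 3.
  have bk (k : 'I_m) : nrm (a (A (f k)) (a (J (proj n u (f k))) phi)) <=
      nrm (A (f k)) * nrm (a (J (f k)) phi) + eta * (nrm (A (f k)) * nrm phi).
    apply: le_trans (nrm_fock_a hJ hF _ _) _.
    rewrite [eta * _]mulrCA -mulrDr ler_wpM2l ?nrm_ge0 //.
    apply: le_trans (nrm_leD _ (a (J (f k)) phi)) _; rewrite lerD2l nrmB.
    rewrite -(fock_aB hF) -(conjugationN hJ) -(conjugationD hJ).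
    apply: le_trans (nrm_fock_a hJ hF _ _) _; rewrite (nrm_conjugation hJ).
    rewrite ler_wpM2r // hNf //; apply: leq_trans Nn; exact: leq_bigmax.
  apply: le_trans (nrm_sum _ _ _) _.
  apply: le_trans (ler_sum _ (fun k _ => bk k)) _.
  rewrite big_split /= lerD //; last first.
    rewrite -mulr_sumr -/S /eta mulrAC ler_pdivrMr // ler_wpM2l ?(ltW d3) //.
    by rewrite lerDl.
  (* Here [x k = |a(J f_k) phi|], [X = |phi|] and [N = p]; the two sums are bounded by the Schatten
     sum and by the number operator. *)
  apply: weighted_sum_bound => //.
  - by move=> k; exact: nrm_ge0.
  - move=> k; rewrite nrm_ge0 /=; apply: le_trans (nrm_fock_a hJ hF _ _) _.
    rewrite (nrm_conjugation hJ) ler_piMl //.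
    exact: orthosystem_le1 hf.1 (ltn_ord k).
  - by apply: fine_ge0; exact: schatten_sum_ge0.
  - exact: eigensystem_schatten hA _ _ hf.
  - exact: (number_pspace hJ hF hf.1 pphi).
have v_le j : nrm (A (v j)) <= eps.
  apply: le_trans (hW _ (fun k km => proj_compl hf.1 (u j) km)) _.
  rewrite ler_piMr ?(ltW eps0) //; apply: le_trans (nrm_projC hf.1 _) _.
  exact: orthosystem_le1 (orthosystem_basis j.+1) _.
(* This keeps the majorant [w], and with it the earlier choice of [M], valid for the remainder. *)
have v_leA j : nrm (A (v j)) <= nrm (A (u j)).
  rewrite -(@ler_pXn2r _ 2) ?nnegrE ?nrm_ge0 // [leRHS](eigensystem_pythagoras AB hf).
  by rewrite lerDr sumr_ge0 // => k _; rewrite mulr_ge0 ?sqr_ge0.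
have tail : nrm (\sum_(j < n) a (A (v j)) (a (J (u j)) phi)) <= d / 3 + d / 3.
  apply: le_trans (nrm_sum _ _ _) _.
  rewrite -(big_mkord xpredT (fun j => nrm (a (A (v j)) (a (J (u j)) phi)))).
  rewrite (big_cat_nat (n := M)) //= lerD //.
    apply: (@le_trans _ _ (\sum_(0 <= j < M) eps * nrm phi)).
      apply: ler_sum => j _; apply: le_trans (nrm_fock_a hJ hF _ _) _.
      by rewrite ler_pM ?nrm_ge0 ?nrm_a_basis.
    rewrite sumr_const_nat subn0 -[leLHS]mulr_natl [leLHS]mulrCA /eps [leLHS]mulrAC ler_pdivrMr //.
    by rewrite ler_wpM2l ?(ltW d3) // lerDl.
  apply: le_trans (hM M n (leqnn M)); apply: ler_sum => j _.
  apply: le_trans (nrm_fock_a hJ hF _ _) _; apply: mul_le_w.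
  by rewrite nrm_ge0 v_leA.
by apply: le_trans (nrmD _ _) _; move: head tail; lra.
Qed.

Lemma Delta_limit_bound (l : F) : (fun n => \sum_(j < n) term phi j) @ \oo --> l ->
  nrm l <= T `^ r^-1 * p%:R `^ ((r - 1) / r) * nrm phi.
Proof. by move=> /lim_nrm_le; apply=> d; exact: Delta_partial_bound. Qed.

End fixed_particle_number.

(** Two annihilation operators lower the particle number by two, so distinct numbers stay distinct.
    Below two particles the limit is zero, which is treated apart because there is no space of index
    [p - 2]. *)
Lemma Delta_limit_orth p q phi psi (l k : F) : p <> q -> pspace p phi -> pspace q psi ->
  (fun n => \sum_(j < n) term phi j) @ \oo --> l ->
  (fun n => \sum_(j < n) term psi j) @ \oo --> k -> inner l k = 0.
Proof.
have vanish s chi t : (s < 2)%N -> pspace s chi ->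
    (fun n => \sum_(j < n) term chi j) @ \oo --> t -> t = 0.
  move=> s2 pchi /lim_nrm_le h; apply: nrm_eq0; apply/eqP.
  rewrite eq_le nrm_ge0 andbT; apply: h => d d0; exists 0%N => n _.
  rewrite add0r big1 ?nrm0 ?ltW // => j _.
  case: s s2 pchi => [|[|//]] _ pchi.
    by rewrite (_ : a _ chi = 0) ?linear0 //; apply: (pspace_a0 hJ hF).
  by rewrite (pspace_a0 hJ hF) //; apply: (pspace_a hJ hF).
have stay s chi t : pspace s.+2 chi ->
    (fun n => \sum_(j < n) term chi j) @ \oo --> t -> pspace s t.
  move=> pchi /cvg_nrmP ct; rewrite /particle_space (closure_id (closure _)).1.
    apply/closure_nrm => d /ct[N hN]; exists (\sum_(j < N) term chi j); last exact: hN.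
    elim/big_ind: _ => [|x y|j _]; first exact: closure_lspan0.
      exact: closure_lspanD.
    by apply: (pspace_a hJ hF); exact: (pspace_a hJ hF).
  exact: closed_closure.
move=> pq pphi ppsi lphi kpsi.
have [p2|p2] := ltnP p 2; first by rewrite (vanish _ _ _ p2 pphi lphi) inner0l.
have [q2|q2] := ltnP q 2; first by rewrite (vanish _ _ _ q2 ppsi kpsi) inner0r.
case: p q p2 q2 pq pphi ppsi => [|[|p]] // [|[|q]] // _ _ pq pphi ppsi.
apply: (pspace_orth hJ hF) (stay _ _ _ pphi lphi) (stay _ _ _ ppsi kpsi).
by move=> pq'; apply: pq; rewrite pq'.
Qed.

Lemma Delta_bound m (phi : nat -> F) : (forall n, pspace n (phi n)) ->
  nrm (Delta J a A D e (\sum_(n < m) phi n)) ^+ 2 <=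
    (T `^ r^-1) ^+ 2 * \sum_(n < m) n%:R `^ (2 * (r - 1) / r) * nrm (phi n) ^+ 2.
Proof.
move=> pphi; have /choice[l hl] := fun n => Delta_cvg (pphi n).
have -> : Delta J a A D e (\sum_(n < m) phi n) = \sum_(n < m) l n.
  apply: cvg_lim; first exact: norm_hausdorff.
  rewrite (_ : (fun n => _) = (fun n => \sum_(i < m) \sum_(j < n) term (phi i) j)).
    by apply: cvg_big => [|i _]; [exact: add_continuous | exact: hl].
  apply/funext => n; rewrite Delta_partial_sum exchange_big /=; apply: eq_bigr => j _.
  by rewrite linear_sum linear_sum.
rewrite nrm_sqr_sum; last first.
  move=> i j ij; apply: Delta_limit_orth (pphi i) (pphi j) (hl i) (hl j).
  by move=> /val_inj ij'; rewrite ij' eqxx in ij.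
rewrite mulr_sumr; apply: ler_sum => i _.
(* The exponent [s] is twice the Hölder exponent [(r - 1) / r], because norms are squared. *)
have -> : i%:R `^ (2 * (r - 1) / r) = (i%:R `^ ((r - 1) / r)) ^+ 2 :> R.
  by rewrite -powR_mulrn ?powR_ge0 // -powRrM -mulrA mulrC.
rewrite mulrA -!exprMn ler_pXn2r ?nnegrE ?mulr_ge0 ?powR_ge0 ?nrm_ge0 //.
by apply: Delta_limit_bound; [exact: pphi | exact: hl].
Qed.

End delta_bound.

(** * Decomposition by particle number, and the theorem *)

Section number_operator.
Variables (R : realType) (L F : hilbertType R).
Variables (adag : L -> {linear F -> F}) (Omega : F).

Local Notation pspace := (particle_space adag Omega).

Lemma finite_particle_decomposition Phi : finite_particle_space adag Omega Phi ->
  exists m (phi : nat -> F), (forall n, pspace n (phi n)) /\ Phi = \sum_(n < m) phi n.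
Proof.
move=> [k [c [v [vp ->]]]].
have /choice[d vd] : forall i, exists n, pspace n (v i).
  by move=> i; have [n _ vn] := vp i; exists n.
(* Vectors of equal particle number are collected; the successor is taken because the sum runs over
   [n < m]. *)
exists (\max_(i < k) d i).+1, (fun n => \sum_(i < k | d i == n) c i *: v i); split.
  move=> n; elim/big_ind: _ => [|x y|i /eqP <-]; first exact: closure_lspan0.
    exact: closure_lspanD.
  by apply: closure_lspanZ; exact: vd.
rewrite (partition_big (fun i => inord (d i) : 'I_(\max_(i < k) d i).+1) xpredT) //=.
apply: eq_bigr => n _; apply: eq_bigl => i.
by rewrite -val_eqE /= inordK // ltnS; exact: leq_bigmax.
Qed.

(** [get] picks a member of a nonempty set. The decomposition that comes with this member is the one
    to which the norm bound is then applied. *)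
Lemma number_pow_decomposition s Phi : finite_particle_space adag Omega Phi ->
  exists m (phi : nat -> F), [/\ forall n, pspace n (phi n),
    Phi = \sum_(n < m) phi n &
    number_pow adag Omega s Phi = \sum_(n < m) ((n%:R : R) `^ s)%:C *: phi n].
Proof.
move=> /finite_particle_decomposition[m [phi [pphi PhiE]]].
apply: (@getPex _ [set Psi | exists (m : nat) (phi : nat -> F),
    [/\ forall n, pspace n (phi n), Phi = \sum_(n < m) phi n &
        Psi = \sum_(n < m) ((n%:R : R) `^ s)%:C *: phi n]]).
by exists (\sum_(n < m) ((n%:R : R) `^ s)%:C *: phi n), m, phi.
Qed.

End number_operator.

Theorem theorem3p6 (R : realType) (L F : hilbertType R)
    (hL : separable L) (J : L -> L) (hJ : conjugation J)
    (a adag : L -> {linear F -> F}) (Omega : F)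
    (hF : fock_representation J a adag Omega)
    (D : set nat) (e : nat -> L) (he : complete_orthonormal D e)
    (r : R) (hr : 1 <= r <= 2)
    (A : {linear L -> L}) (hA : skew_schatten_class J r A)
    (s : R) (hs : s = 2 * (r - 1) / r) :
  (r = 1 ->
    forall Phi : F, finite_particle_space adag Omega Phi ->
      `|Delta J a A D e Phi| ^+ 2
        <= (schatten_norm 1 A ^+ 2)%:C * inner Phi Phi) /\
  (1 < r ->
    forall Phi : F, finite_particle_space adag Omega Phi ->
      `|Delta J a A D e Phi| ^+ 2
        <= (schatten_norm r A ^+ 2)%:C
             * inner Phi (number_pow adag Omega s Phi)
           + (schatten_norm 2 A ^+ 2)%:C * inner Phi Phi).
Proof.
have [cA /(skew_adjoint hJ) AB] := hA.
have bound := Delta_bound hJ hF he hr cA AB.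
have inner_diag (t : R) m (phi : nat -> F) : (forall n, particle_space adag Omega n (phi n)) ->
    inner (\sum_(n < m) phi n) (\sum_(n < m) ((n%:R : R) `^ t)%:C *: phi n) =
    (\sum_(n < m) n%:R `^ t * nrm (phi n) ^+ 2)%:C.
  move=> pphi; rewrite inner_suml rmorph_sum; apply: eq_bigr => i _ /=.
  rewrite inner_sumr (bigD1 i) //= big1 ?addr0 => [|j ji].
    by rewrite innerZr inner_nrm -rmorphM.
  rewrite innerZr (pspace_orth hJ hF _ (pphi i) (pphi j)) ?mulr0 //.
  by move=> /val_inj ij; rewrite ij eqxx in ji.
split=> [r1|r1] Phi hPhi; rewrite nrmE -rmorphXn /=.
  have [m [phi [pphi PhiE]]] := finite_particle_decomposition hPhi.
  have -> : inner Phi Phi = (\sum_(n < m) n%:R `^ 0 * nrm (phi n) ^+ 2)%:C.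
    rewrite -inner_diag // PhiE; congr (inner _ _).
    by apply: eq_bigr => i _; rewrite powRr0 scale1r.
  rewrite -rmorphM lecR /=; have := bound m phi pphi.
  by rewrite -PhiE /schatten_norm r1 subrr mulr0 mul0r.
have [m [phi [pphi PhiE ->]]] := number_pow_decomposition s hPhi.
(* The bound on [Delta] gives the first summand of the right side; the second one is nonnegative. *)
apply: (@le_trans _ _ ((schatten_norm r A ^+ 2)%:C *
    inner Phi (\sum_(n < m) ((n%:R : R) `^ s)%:C *: phi n))).
  rewrite PhiE inner_diag // -rmorphM lecR /= hs; exact: bound.
by rewrite lerDl inner_nrm -rmorphM ler0c mulr_ge0 ?sqr_ge0.
Qed.
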